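(* Let $\mathfrak{g}$ be the real Lie algebra $\mathfrak{sl}_3(\mathbf{C})$ and let $\mathfrak{g}\to\mathrm{End}(W)$ be a faithful finite dimensional real representation such that there is a symmetric bilinear $\mathfrak{g}$-equivariant map $\wedge:W\times W\to W^*$ which does not vanish identically on any $2$-dimensional linear subspace of $W$. Then, after composing the representation with an automorphism of $\mathfrak{g}$, there exist integers $k,l,m\geq 0$ such that $$W\simeq \mathrm{Her}(E_{\mathbf{C}}^* )\oplus E_{\mathbf{C}}^k\oplus \overline{E_{\mathbf{C}}}^{\,l}\oplus T^m$$ as real representations of $\mathfrak{g}$.
   Context: $E_{\mathbf{C}}=\mathbf{C}^3$ with its standard action of $\mathfrak{sl}_3(\mathbf{C})$ (viewed as a real representation), $\overline{E_{\mathbf{C}}}$ its complex conjugate representation, $\mathrm{Her}(E_{\mathbf{C}}^* )$ the real representation on hermitian forms on $\mathbf{C}^3$, $T$ the trivial one-dimensional real representation, and $V^k$ the direct sum of $k$ copies of $V$. Equivariance of $\wedge$ means $X\cdot(a\wedge b)=(X\cdot a)\wedge b+a\wedge(X\cdot b)$. *)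

(* Defs.v *)
From HB Require Import structures.
From mathcomp Require Import all_boot all_order all_algebra.
Set Implicit Arguments. Unset Strict Implicit. Unset Printing Implicit Defensive.
Import Order.TTheory GRing.Theory Num.Theory.
Local Open Scope ring_scope.

Section Defs.
Variable R : rcfType.

(* A complex m x n matrix Z = Z.1 + i Z.2 is a pair of real matrices. *)
Definition cmx m n := ('M[R]_(m, n) * 'M[R]_(m, n))%type.

Definition cadd m n (A B : cmx m n) : cmx m n := (A.1 + B.1, A.2 + B.2).
Definition cscale m n (a : R) (A : cmx m n) : cmx m n := (a *: A.1, a *: A.2).
Definition cneg m n (A : cmx m n) : cmx m n := (- A.1, - A.2).
Definition czero m n : cmx m n := (0, 0).
Definition cmul m n p (A : cmx m n) (B : cmx n p) : cmx m p :=
  (A.1 *m B.1 - A.2 *m B.2, A.1 *m B.2 + A.2 *m B.1).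
Definition cconj m n (A : cmx m n) : cmx m n := (A.1, - A.2).
Definition cadj m n (A : cmx m n) : cmx n m := (A.1^T, - A.2^T).

Definition sl3 (X : cmx 3 3) : Prop := \tr X.1 = 0 /\ \tr X.2 = 0.
Definition lie (X Y : cmx 3 3) : cmx 3 3 := cadd (cmul X Y) (cneg (cmul Y X)).

(* real representation of sl_3(C) on W = R^n (column vectors), given by rho
   (only its values on sl3 matter) *)
Definition is_rep n (rho : cmx 3 3 -> 'M[R]_n) : Prop :=
  (forall (a : R) X Y, sl3 X -> sl3 Y ->
     rho (cadd (cscale a X) Y) = a *: rho X + rho Y) /\
  (forall X Y, sl3 X -> sl3 Y ->
     rho (lie X Y) = rho X *m rho Y - rho Y *m rho X).

Definition faithful n (rho : cmx 3 3 -> 'M[R]_n) : Prop :=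
  forall X Y, sl3 X -> sl3 Y -> rho X = rho Y -> X = Y.

(* wedge : W x W -> W^*, elements of W^* being row vectors (f(v) = f *m v) *)
Definition sym_bilinear n (w : 'cV[R]_n -> 'cV[R]_n -> 'rV[R]_n) : Prop :=
  (forall (a : R) u v x, w (a *: u + v) x = a *: w u x + w v x) /\
  (forall u v, w u v = w v u).

(* equivariance: X.(a ^ b) = (X.a) ^ b + a ^ (X.b), with the dual action
   (X.f)(v) = - f(X.v) on W^* *)
Definition equivariant n (rho : cmx 3 3 -> 'M[R]_n)
    (w : 'cV[R]_n -> 'cV[R]_n -> 'rV[R]_n) : Prop :=
  forall X u v, sl3 X ->
    - (w u v *m rho X) = w (rho X *m u) v + w u (rho X *m v).

Definition nondeg2 n (w : 'cV[R]_n -> 'cV[R]_n -> 'rV[R]_n) : Prop :=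
  forall u v : 'cV[R]_n,
    (forall a b : R, a *: u + b *: v = 0 -> a = 0 /\ b = 0) ->
    exists a b c d : R, w (a *: u + b *: v) (c *: u + d *: v) != 0.

Definition lie_aut (phi : cmx 3 3 -> cmx 3 3) : Prop :=
  [/\ forall X, sl3 X -> sl3 (phi X),
      forall (a : R) X Y, sl3 X -> sl3 Y ->
        phi (cadd (cscale a X) Y) = cadd (cscale a (phi X)) (phi Y),
      forall X Y, sl3 X -> sl3 Y -> phi (lie X Y) = lie (phi X) (phi Y),
      forall X Y, sl3 X -> sl3 Y -> phi X = phi Y -> X = Y &
      forall Y, sl3 Y -> exists2 X, sl3 X & phi X = Y].

(* The model representation Her(E_C^* ) (+) E_C^k (+) conj(E_C)^l (+) T^m.
   Her(E^* ): hermitian 3x3 complex matrices H (forms z^* H w on C^3),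
     X.H = - (X^* H + H X);
   E^k: complex 3 x k matrices (k columns = k copies of C^3), X.Z = X Z;
   conj(E)^l: complex 3 x l matrices, X.Z = conj(X) Z;
   T^m: real column vectors of size m, trivial action. *)
Definition model k l m :=
  (cmx 3 3 * cmx 3 k * cmx 3 l * 'cV[R]_m)%type.

Definition hermitian (H : cmx 3 3) : Prop := H.1^T = H.1 /\ H.2^T = - H.2.

Definition model_add k l m (s t : model k l m) : model k l m :=
  (cadd s.1.1.1 t.1.1.1, cadd s.1.1.2 t.1.1.2, cadd s.1.2 t.1.2, s.2 + t.2).
Definition model_scale k l m (a : R) (t : model k l m) : model k l m :=
  (cscale a t.1.1.1, cscale a t.1.1.2, cscale a t.1.2, a *: t.2).
Definition model_act k l m (X : cmx 3 3) (t : model k l m) : model k l m :=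
  (cneg (cadd (cmul (cadj X) t.1.1.1) (cmul t.1.1.1 X)),
   cmul X t.1.1.2, cmul (cconj X) t.1.2, 0).

Definition model_iso n k l m (rho : cmx 3 3 -> 'M[R]_n)
    (f : 'cV[R]_n -> model k l m) : Prop :=
  [/\ forall (a : R) u v, f (a *: u + v) = model_add (model_scale a (f u)) (f v),
      injective f,
      forall v, hermitian (f v).1.1.1,
      forall t : model k l m, hermitian t.1.1.1 -> exists v, f v = t &
      forall X v, sl3 X -> f (rho X *m v) = model_act X (f v)].

End Defs.

(* Main.v *)
(** Let A be the real diagonal torus.  An sl2-argument shows that A acts on W
    diagonalizably, with integral weights stable under permutation of the
    coordinates.  If u, v have weights c, d and u ^ v <> 0, then -(c + d) is a
    weight of W.  Hence, for a weight c of maximal norm, the weight space of c is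
    a line (otherwise -2c would be a weight), and two distinct maximal weights c,
    d have -(c + d) as a weight, so make an angle of at least 120 degrees; this
    forces c = -x e_i, with x > 0 after composing with X |-> -X^T.  If v spans
    this line, E_ij v and i E_ij v are independent of weight c' = c + e_i - e_j,
    so -2c' is a weight, which by maximality gives (x - 2)^2 <= 0.  With x = 2 the
    same argument excludes all weights other than 0, e_i and -2 e_i.  The weight
    space of 0 is T^m, the vectors generated by v form Her(E^* ), and the vectors
    of weight e_i killed by all E_pq, i E_pq with q <> i carry a complex structure
    and yield copies of E.  As real representations E and its conjugate are
    isomorphic by complex conjugation, so l = 0 suffices. *)

From Stdlib Require Import Classical ClassicalEpsilon.
Require Import Defs.
From HB Require Import structures.
From mathcomp Require Import all_boot all_order all_algebra.
From mathcomp Require Import ring lra zify.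
Import Order.TTheory GRing.Theory Num.Theory.
Local Open Scope ring_scope.
Set Implicit Arguments. Unset Strict Implicit. Unset Printing Implicit Defensive.

(** Everything is extracted from commutation relations. For an sl2-triple, nilpotency of e and f
    makes e^k f^k and f^k e^k vanish for large k; both are products of commuting operators built
    from f e and h, and comparing their factors splits h over the integers with simple roots. The
    representation is only real: i E_ij acts by an operator with no a priori link to that of E_ij,
    and the action of i (E_ii - E_jj) is unknown. That it kills the extremal vector v has to be
    derived: it preserves the line of v, and its scalar there vanishes because E_aj^2 v, E_aj (i
    E_aj) v and (i E_aj)^2 v all lie on one line. On the vectors that behave like e_a the same
    operator squares to -1 and is their complex structure. The isomorphism is built as an explicit
    map from the model to W. Equivariance is checked on the root elements of row and column a and
    passes to brackets. Bijectivity is checked on weight spaces: that of weight e_i mixes a part of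
    Her with a part of E, and the two are separated by operators E_pq, i E_pq that kill the
    second. *)

Ltac mx_ring := apply/matrixP => ? ?; rewrite !mxE; ring.

Ltac gen_mul := repeat match goal with
  |- context [@mulmx _ _ _ _ ?A ?B] => move: (A *m B) => ?
  end.

(** * Representations of sl2 *)

Section Sl2.
Variables (R : realFieldType) (n' : nat).
Local Notation n := n'.+1.
Implicit Types (e f h : 'M[R]_n).

Record sl2_triple e f h : Prop := Sl2Triple {
  sl2_ef : e *m f = f *m e + h;
  sl2_he : h *m e = e *m h + 2 *: e;
  sl2_hf : h *m f = f *m h - 2 *: f }.

Lemma sl2_triple_swap e f h : sl2_triple e f h -> sl2_triple f e (- h).
Proof.
case=> ef he hf; split; first by rewrite ef addrK.
- rewrite mulNmx mulmxN hf; mx_ring.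
- rewrite mulNmx mulmxN he; mx_ring.
Qed.

(** The relation gives [h, e^k] = 2k e^k, so a nonzero e^k is an eigenvector of ad h for the
    eigenvalue 2k. Were e^k nonzero for all k = 0, ..., n^2, ad h would have n^2 + 1 distinct
    eigenvalues on a space of dimension n^2. *)
Lemma ad_eigen_nilpotent e h : h *m e = e *m h + 2 *: e -> exists N, e ^+ N = 0.
Proof.
move=> he.
pose A := lin_mulmx h - lin_mulmxr h : 'M[R]_(n * n).
have eig k : h *m e ^+ k = e ^+ k *m h + (2 * k%:R) *: e ^+ k.
  elim: k => [|k IH]; first by rewrite mulr0 scale0r addr0 expr0 mulmx1 mul1mx.
  rewrite exprSr -!mulmxE mulmxA IH mulmxDl -scalemxAl -mulmxA he mulmxDr -scalemxAr.
  rewrite -addrA -scalerDl -mulmxA; congr (_ + _ *: _).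
  by rewrite -[k.+1%:R]natr1; ring.
pose p := char_poly A.
have sp : size p = (n * n).+1 by rewrite size_char_poly.
have [/existsP[k /eqP ek]|/existsPn nz] :=
    boolP [exists k : 'I_(n * n).+1, e ^+ k == 0]; first by exists k.
pose rs := [seq 2 * k%:R : R | k <- iota 0 (n * n).+1].
have urs : uniq rs.
  rewrite map_inj_uniq ?iota_uniq // => i j /(mulfI _) eij.
  by apply/eqP; rewrite -(eqr_nat R) eij // pnatr_eq0.
have rrs : all (root p) rs.
  apply/allP => x /mapP[k]; rewrite mem_iota => /= kn ->.
  rewrite -eigenvalue_root_char.
  apply/eigenvalueP; exists (mxvec (e ^+ k)); last first.
    by rewrite mxvec_eq0; exact: nz (Ordinal kn).
  rewrite mulmxBr !mul_vec_lin /= eig -linearB -linearZ /=; congr mxvec.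
  by rewrite addrAC subrr add0r.
have p0 : p != 0 by rewrite -size_poly_eq0 sp.
by have := max_poly_roots p0 rrs urs; rewrite size_map size_iota sp ltnn.
Qed.

Section Triple.
Variables (e f h : 'M[R]_n).
Hypothesis ht : sl2_triple e f h.

Lemma sl2_e_fX r :
  e *m f ^+ r.+1 = f ^+ r.+1 *m e + r.+1%:R *: (f ^+ r *m (h - r%:R%:M)).
Proof.
case: ht => ef he hf.
elim: r => [|r IH].
  by rewrite expr1 expr0 mul1mx scale1r ef raddf0 subr0.
rewrite exprSr -mulmxE mulmxA IH mulmxDl -mulmxA ef mulmxDr mulmxA -scalemxAl.
rewrite -!mulmxA mulmxBl hf mul_scalar_mx -addrA; congr (_ + _).
rewrite [in RHS]exprSr -mulmxE -[in RHS]mulmxA.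
rewrite -?scalemxAr -?scalerDr /=.
have -> : f ^+ r.+1 *m h = f ^+ r *m (f *m h) by rewrite exprSr -mulmxE mulmxA.
rewrite scalemxAr -mulmxDr scalemxAr; congr (_ *m _).
rewrite mulmxBr mul_mx_scalar.
rewrite -!(natr1 r) -(natr1 r.+1) -(natr1 r).
mx_ring.
Qed.

(* By induction on s, applied to e v: no complete reducibility is needed. *)
Lemma sl2_lowering_inj m (v : 'M[R]_(n, m)) (k : R) (r s : nat) :
  h *m v = k *: v -> r%:R <= k -> f ^+ r *m v = 0 -> e ^+ s *m v = 0 -> v = 0.
Proof.
case: (ht) => _ he _.
elim: s v k r => [|s IHs] v k r hv rk fv; first by rewrite expr0 mul1mx.
move=> ev.
have {}IHs : f ^+ r.+1 *m (e *m v) = 0 -> e *m v = 0.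
  move=> H; apply: (IHs _ (k + 2) r.+1) => //.
  - by rewrite mulmxA he mulmxDl -mulmxA hv -scalemxAr -scalemxAl [RHS]scalerDl.
  - rewrite -[r.+1%:R]natr1; lra.
  - by rewrite mulmxA mulmxE -exprSr.
have low j : (f ^+ j.+1 *m (e *m v)) = 
   e *m (f ^+ j.+1 *m v) - (j.+1%:R * (k - j%:R)) *: (f ^+ j *m v).
  rewrite !mulmxA sl2_e_fX mulmxDl -scalemxAl -[_ *m (h - _) *m _]mulmxA mulmxBl hv.
  by rewrite mul_scalar_mx -scalerBl -scalemxAr scalerA addrK.
have ev0 : e *m v = 0.
  apply: IHs; rewrite low fv scaler0 subr0 exprS -mulmxE -(mulmxA f) fv.
  by rewrite !mulmx0.
(* Now e v = 0, so [low] reads (r + 1)(k - r) f^r v = 0. Since r + 1 <= k the coefficient is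
   nonzero, and the exponent of f descends to 0. *)
elim: r rk fv {IHs} => [|r IHr] rk fv; first by move: fv; rewrite expr0 mul1mx.
apply: IHr; first by apply: le_trans rk; rewrite ler_nat.
have := low r; rewrite ev0 fv !mulmx0 sub0r => /esym/eqP.
rewrite oppr_eq0 scaler_eq0 mulf_eq0 pnatr_eq0 /= => /orP[|/eqP//].
move: rk; rewrite -[r.+1%:R]natr1 => rk; rewrite subr_eq0 => /eqP kr.
by move: rk; rewrite kr gerDl ler10.
Qed.

(* With C = (h + 1)^2 + 4 f e one has 4 a_i = C - (h - 2i - 1)^2 and
   4 b_j = C - (h + 2j + 1)^2.  These commute, e^k f^k is the product of the a_i
   and f^k e^k the product of the b_j (i, j < k), and the differences a_i - b_j
   and b_i - b_j are affine in h: this splits h over the integers, and shows that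
   its eigenvalues are semisimple. *)
Let a_ i := f *m e + i.+1%:R *: (h - i%:R%:M).
Let b_ j := f *m e - j%:R *: (h + j.+1%:R%:M).

Let comm_fe : h *m (f *m e) = f *m e *m h.
Proof.
case: ht => ef he hf.
rewrite mulmxA hf mulmxBl -(mulmxA f h e) he mulmxDr -scalemxAr -scalemxAl mulmxA.
by rewrite addrK.
Qed.

Let ab_eq i j : a_ i - b_ j = (i + j).+1%:R *: (h - (i%:R - j%:R)%:M).
Proof.
rewrite /a_ /b_ -[(i + j).+1%:R]natr1 natrD -[i.+1%:R]natr1 -[j.+1%:R]natr1.
apply/matrixP => x y; rewrite !mxE; case: (x == y); rewrite ?mulr1n ?mulr0n; ring.
Qed.

Let bb_eq i j : b_ i - b_ j = (j%:R - i%:R) *: (h + (i + j).+1%:R%:M).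
Proof.
rewrite /b_ -[(i + j).+1%:R]natr1 natrD -[i.+1%:R]natr1 -[j.+1%:R]natr1.
apply/matrixP => x y; rewrite !mxE; case: (x == y); rewrite ?mulr1n ?mulr0n; ring.
Qed.

Lemma eX_fX_factor k m (v : 'M[R]_(n, m)) :
  foldr mulmx v [seq a_ i | i <- iota 0 k] = e ^+ k *m (f ^+ k *m v).
Proof.
elim: k v => [|k IH] v; first by rewrite !expr0 !mul1mx.
have -> : iota 0 k.+1 = iota 0 k ++ [:: k] by rewrite -addn1 iotaD.
rewrite map_cat foldr_cat IH /= !mulmxA.
congr (_ *m _); rewrite exprSr -!mulmxE -!mulmxA; congr (_ *m _).
by rewrite /a_ sl2_e_fX // mulmxDr -scalemxAr [in RHS]exprSr -mulmxE -mulmxA.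
Qed.

Let foldr_comm m (A : 'M[R]_n) (g : nat -> 'M[R]_n) s (v : 'M[R]_(n, m)) :
  (forall i, A *m g i = g i *m A) ->
  A *m foldr mulmx v [seq g i | i <- s] = foldr mulmx (A *m v) [seq g i | i <- s].
Proof. by move=> Ag; elim: s => //= i s IH; rewrite mulmxA Ag -mulmxA IH. Qed.

Let comm_h c x : h *m (f *m e + c *: (h + x%:M)) = (f *m e + c *: (h + x%:M)) *m h.
Proof.
rewrite mulmxDr mulmxDl comm_fe; congr (_ + _).
by rewrite -scalemxAr -scalemxAl mulmxDr mulmxDl scalar_mxC.
Qed.

Let comm_c c x : f *m e *m (f *m e + c *: (h + x%:M)) =
   (f *m e + c *: (h + x%:M)) *m (f *m e).
Proof.
rewrite mulmxDr mulmxDl; congr (_ + _).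
by rewrite -scalemxAr -scalemxAl mulmxDr mulmxDl comm_fe scalar_mxC.
Qed.

Let comm2 c x d y : (f *m e + c *: (h + x%:M)) *m (f *m e + d *: (h + y%:M)) =
  (f *m e + d *: (h + y%:M)) *m (f *m e + c *: (h + x%:M)).
Proof.
rewrite mulmxDl comm_c [RHS]mulmxDr; congr (_ + _).
rewrite -scalemxAl -scalemxAr; congr (_ *: _).
by rewrite [LHS]mulmxDl comm_h [RHS]mulmxDr scalar_mxC.
Qed.

Let aN i : a_ i = f *m e + i.+1%:R *: (h + (- i%:R)%:M).
Proof. by rewrite /a_ raddfN. Qed.

Let bN i : b_ i = f *m e + (- i%:R) *: (h + i.+1%:R%:M).
Proof. by rewrite /b_ scaleNr. Qed.

Let intpoly (s : seq int) : {poly R} := \prod_(x <- s) ('X - (x%:~R)%:P).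

Lemma horner_mx_XsubC (c : R) : horner_mx h ('X - c%:P) = h - c%:M.
Proof. by rewrite rmorphB /= horner_mx_X horner_mx_C. Qed.

(** Induction on the total number of factors. It applies to a_i v, which needs one a-factor less,
    and to b_j v, which needs one b-factor less. The difference a_i v - b_j v is (i + j + 1)(h - (i
    - j)) v, so both polynomials together with the factor X - (i - j) kill v. *)
Lemma int_split m (v : 'M[R]_(n, m)) I J :
  foldr mulmx v [seq a_ i | i <- I] = 0 -> foldr mulmx v [seq b_ j | j <- J] = 0 ->
  exists s, horner_mx h (intpoly s) *m v = 0.
Proof.
have [k] := ubnP (size I + size J); elim: k => // k IHk in I J v *.
case: I => [|i I]; first by move=> _ /= -> _; exists [::]; rewrite mulmx0.
case: J => [|j J]; first by move=> _ _ /= ->; exists [::]; rewrite mulmx0.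
rewrite /= ltnS addnS => szk av bv.
have [|||s sP] := IHk I (j :: J) (a_ i *m v).
- by rewrite /= addnS -addSn.
- rewrite -[LHS]foldr_comm // => x; rewrite !aN; exact: comm2.
- rewrite /= -[foldr _ _ _]foldr_comm; last by move=> x; rewrite aN bN comm2.
  by rewrite mulmxA aN bN comm2 -mulmxA -bN bv mulmx0.
have [|||t tP] := IHk (i :: I) J (b_ j *m v).
- by [].
- rewrite /= -[foldr _ _ _]foldr_comm; last by move=> x; rewrite aN bN comm2.
  by rewrite mulmxA aN bN comm2 -mulmxA -aN av mulmx0.
- rewrite -[LHS]foldr_comm // => x; rewrite !bN; exact: comm2.
exists (i%:Z - j%:Z :: s ++ t).
rewrite /intpoly big_cons -/(intpoly _) mulrC rmorphM /= -mulmxE -mulmxA.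
have -> : horner_mx h ('X - (i%:Z - j%:Z)%:~R%:P) *m v =
          (i + j).+1%:R^-1 *: (a_ i *m v - b_ j *m v).
  rewrite -mulmxBl ab_eq -scalemxAl scalerA mulVf ?pnatr_eq0 // scale1r.
  by rewrite horner_mx_XsubC intrB.
rewrite -scalemxAr mulmxBr /intpoly big_cat /= -!/(intpoly _) {1}mulrC !rmorphM /=.
by rewrite -!mulmxE -!mulmxA sP tP !mulmx0 subrr scaler0.
Qed.

(** A product of distinct linear factors shares with (X - k)^2 at most one factor X - k. Factors
    with l <> k are cancelled one by one; once l = k is met, (h - k) v is an eigenvector on which
    the remaining product acts by a nonzero scalar. *)
Let distinct_shift m (v : 'M[R]_(n, m)) (ls : seq R) (k : R) :
  uniq ls -> horner_mx h (\prod_(l <- ls) ('X - l%:P)) *m v = 0 ->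
  (h - k%:M) *m ((h - k%:M) *m v) = 0 -> (h - k%:M) *m v = 0.
Proof.
elim: ls v => [|l ls IH] v /=; first by rewrite big_nil rmorph1 mul1mx => _ -> _; rewrite mulmx0.
move=> /andP[lls uls]; rewrite big_cons mulrC rmorphM /= horner_mx_XsubC -mulmxE -mulmxA => lv kv.
have hk u : (h - k%:M) *m u = h *m u - k *: u :> 'M_(n, m).
  by rewrite mulmxBl mul_scalar_mx.
have hl u : (h - l%:M) *m u = (h - k%:M) *m u + (k - l) *: u :> 'M_(n, m).
  by rewrite !mulmxBl !mul_scalar_mx scalerBl addrA subrK.
have [lk|lk] := eqVneq l k; last first.
  have: (h - k%:M) *m ((h - l%:M) *m v) = 0.
    by apply: IH => //; rewrite hl !mulmxDr kv mulmx0 !add0r -!scalemxAr kv scaler0.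
  rewrite hl mulmxDr kv add0r -scalemxAr => /eqP.
  by rewrite scaler_eq0 subr_eq0 eq_sym (negPf lk) => /eqP.
move: lv; rewrite lk; set w := _ *m v => lv.
have hp (p : {poly R}) : horner_mx h p *m w = p.[k] *: w.
  have hw : h *m w = k *: w by apply/eqP; rewrite -subr_eq0 -hk /w kv.
  elim/poly_ind: p => [|p c IHp]; first by rewrite rmorph0 horner0 mul0mx scale0r.
  rewrite hornerMXaddC rmorphD rmorphM /= horner_mx_X horner_mx_C -mulmxE mulmxDl.
  by rewrite -mulmxA hw -scalemxAr IHp mul_scalar_mx scalerA scalerDl mulrC.
move: lv; rewrite hp => /eqP; rewrite scaler_eq0 horner_prod prodf_seq_eq0.
case/orP => [/hasP[x xls /=]|/eqP//]; rewrite hornerXsubC subr_eq0 -lk => /eqP lx.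
by rewrite lx xls in lls.
Qed.

(** Induction on J. If b_j alone kills v, each a_i acts on v as (i + j + 1)(h - (i - j)), and e^N
    f^N = 0 yields a polynomial with distinct roots that kills v. If two indices j, j' remain,
    induction gives (h - k) b_j v = (h - k) b_j' v = 0; subtracting, (h + j + j' + 1)(h - k) v = 0,
    where h acts as k. Here k >= 0 makes k + j + j' + 1 nonzero. *)
Lemma jordan_free_lowering m (v : 'M[R]_(n, m)) (N : nat) J (k : R) :
  f ^+ N = 0 -> uniq J -> 0 <= k -> foldr mulmx v [seq b_ j | j <- J] = 0 ->
  (h - k%:M) *m ((h - k%:M) *m v) = 0 -> (h - k%:M) *m v = 0.
Proof.
move=> fN + k0.
have hb j u : (h - k%:M) *m (b_ j *m u) = b_ j *m ((h - k%:M) *m u) :> 'M_(n, m).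
  rewrite !mulmxA; congr (_ *m _); rewrite bN mulmxBl mulmxBr comm_h.
  by rewrite scalar_mxC.
have [M] := ubnP (size J); elim: M => // M IH in J v *.
case: J => [|j [|j' J]]; first by move=> _ _ /= -> _; rewrite mulmx0.
- move=> _ _ /= bv kv.
  apply: (@distinct_shift _ _ [seq i%:R - j%:R | i <- iota 0 N]) => //.
    rewrite map_inj_uniq ?iota_uniq // => x y /addIr/eqP.
    by rewrite eqr_nat => /eqP.
  have av0 : foldr mulmx v [seq a_ i | i <- iota 0 N] = 0.
    by rewrite eX_fX_factor fN mul0mx mulmx0.
  have bh p : b_ j *m (horner_mx h p *m v) = 0.
    rewrite mulmxA (_ : b_ j *m _ = horner_mx h p *m b_ j) -?mulmxA ?bv ?mulmx0 //.
    by apply: comm_mx_horner; rewrite /comm_mx bN comm_h.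
  have main t : exists2 c, c != 0 & foldr mulmx v [seq a_ i | i <- t] = c *:
      (horner_mx h (\prod_(l <- [seq i%:R - j%:R | i <- t]) ('X - l%:P)) *m v).
    elim: t => [|i t [d d0 dP]] /=.
      by exists 1; rewrite ?oner_eq0 // big_nil rmorph1 mul1mx scale1r.
    exists ((i + j).+1%:R * d); first by rewrite mulf_neq0 ?pnatr_eq0.
    rewrite dP big_cons rmorphM /= horner_mx_XsubC -mulmxE -mulmxA -scalerA -scalemxAr.
    rewrite [RHS]scalerA mulrC -scalerA; congr (_ *: _).
    by rewrite scalemxAl -ab_eq mulmxBl bh subr0.
  have [d d0 dP] := main (iota 0 N); move/eqP: av0; rewrite dP scaler_eq0 (negPf d0).
  by move/eqP.
move=> szJ /= /andP[/norP[jj' jJ] /andP[j'J uJ]] bv kv.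
have eq1 : (h - k%:M) *m (b_ j *m v) = 0.
  apply: (IH (j' :: J)) => //=.
  - by rewrite j'J.
  - rewrite -(@foldr_comm _ (b_ j)); last by move=> x; rewrite !bN comm2.
    by rewrite mulmxA !bN comm2 -!bN -mulmxA.
  - by rewrite !hb kv mulmx0.
have eq2 : (h - k%:M) *m (b_ j' *m v) = 0.
  apply: (IH (j :: J)) => //=.
  - by rewrite jJ.
  - by rewrite -(@foldr_comm _ (b_ j')) // => x; rewrite !bN; exact: comm2.
  - by rewrite !hb kv mulmx0.
have := bb_eq j j' => /(congr1 (mulmx^~ ((h - k%:M) *m v))).
rewrite mulmxBl -!hb eq1 eq2 subrr => /esym/eqP; rewrite -scalemxAl scaler_eq0.
rewrite subr_eq0 eqr_nat eq_sym (negPf jj') /= => /eqP.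
have -> : h + (j + j').+1%:R%:M = (h - k%:M) + (k + (j + j').+1%:R)%:M.
  by rewrite raddfD /= addrA subrK.
rewrite mulmxDl kv add0r mul_scalar_mx => /eqP; rewrite scaler_eq0 paddr_eq0 //.
by rewrite pnatr_eq0 andbF => /eqP.
Qed.

End Triple.

Section Diag.
Variables (e f h : 'M[R]_n).
Hypothesis ht : sl2_triple e f h.

Lemma sl2_nilpotent : exists N, e ^+ N = 0 /\ f ^+ N = 0.
Proof.
case: (ht) => ef he hf.
have [N eN] := ad_eigen_nilpotent he.
have [|M fM] := @ad_eigen_nilpotent f (- h); first exact: sl2_he (sl2_triple_swap ht).
by exists (N + M)%N; rewrite !exprD eN fM mul0r mulr0.
Qed.

(** Passing to the triple (f, e, -h) turns each a_i into b_i, here written out. *)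
Lemma fX_eX_factor k m (v : 'M[R]_(n, m)) :
  foldr mulmx v [seq f *m e - i%:R *: (h + i.+1%:R%:M) | i <- iota 0 k] =
  f ^+ k *m (e ^+ k *m v).
Proof.
rewrite -(eX_fX_factor (sl2_triple_swap ht)); congr foldr; apply: eq_map => i.
rewrite (sl2_ef ht) -[i.+1%:R]natr1; apply/matrixP => x y.
by rewrite !mxE; case: (x == y); rewrite ?mulr1n ?mulr0n; ring.
Qed.

Lemma jordan_free_ge0 (k : int) m (v : 'M[R]_(n, m)) : 0 <= k ->
  (h - k%:~R%:M) *m ((h - k%:~R%:M) *m v) = 0 -> (h - k%:~R%:M) *m v = 0.
Proof.
have [N [eN fN]] := sl2_nilpotent.
move=> k0; apply: (@jordan_free_lowering e f h ht _ _ N (iota 0 N)) => //.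
- exact: iota_uniq.
- by rewrite ler0z.
- by rewrite fX_eX_factor eN mul0mx mulmx0.
Qed.
End Diag.

Section Diag2.
Variables (e f h : 'M[R]_n).
Hypothesis ht : sl2_triple e f h.

Lemma jordan_free (k : int) m (v : 'M[R]_(n, m)) :
  (h - k%:~R%:M) *m ((h - k%:~R%:M) *m v) = 0 -> (h - k%:~R%:M) *m v = 0.
Proof.
have [k0|k0] := leP 0 k; first exact: (jordan_free_ge0 ht).
have -> : h - k%:~R%:M = - (- h - (- k)%:~R%:M) by rewrite intrN raddfN opprD !opprK.
rewrite !mulNmx mulmxN opprK => /(jordan_free_ge0 (sl2_triple_swap ht)) -> //.
  by rewrite oppr0.
by rewrite oppr_ge0 ltW.
Qed.

Lemma sl2_diagonalizable : exists2 s : seq int, uniq s &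
  horner_mx h (\prod_(x <- s) ('X - (x%:~R)%:P)) = 0.
Proof.
have [N [eN fN]] := sl2_nilpotent ht.
have [s sP] : exists s : seq int, horner_mx h (\prod_(x <- s) ('X - (x%:~R)%:P)) *m 1%:M = 0.
  apply: (@int_split e f h ht _ 1%:M (iota 0 N) (iota 0 N)).
    by rewrite eX_fX_factor // fN mul0mx mulmx0.
  by rewrite fX_eX_factor // eN mul0mx mulmx0.
(* The polynomial found may have repeated roots. They are removed one at a time: if the reduced
   product contains X - k and kills (h - k) v, then (h - k)^2 p v = 0 for the cofactor p, and
   [jordan_free] drops one factor. *)
exists (undup s); first exact: undup_uniq.
rewrite -[LHS]mulmx1; elim: s (1%:M : 'M[R]_n) sP => //= k s IH v.
rewrite big_cons mulrC rmorphM /= -mulmxE -mulmxA => /IH {}IH.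
case: ifPn => ks; last by rewrite big_cons mulrC rmorphM /= -mulmxE -mulmxA.
rewrite -mem_undup in ks.
have [p [pE hp]] : exists p, horner_mx h (\prod_(x <- undup s) ('X - (x%:~R)%:P)) =
    (h - k%:~R%:M) *m p /\ p *m (h - k%:~R%:M) = (h - k%:~R%:M) *m p.
  rewrite (big_rem _ ks) /= rmorphM -horner_mx_XsubC.
  by eexists; split; [reflexivity|exact: comm_horner_mx2].
rewrite pE horner_mx_XsubC in IH; rewrite pE -mulmxA.
apply: (jordan_free (k := k)); rewrite -[RHS]IH !mulmxA; congr (_ *m _).
by rewrite -[RHS]mulmxA hp mulmxA.
Qed.
End Diag2.
End Sl2.

(** * Weights *)

Section Generators.
Variable R : rcfType.

Definition matE (i j : 'I_3) : cmx R 3 3 := (delta_mx i j, 0).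
Definition matiE (i j : 'I_3) : cmx R 3 3 := (0, delta_mx i j).
Definition matH (i j : 'I_3) : cmx R 3 3 := (delta_mx i i - delta_mx j j, 0).
Definition matiH (i j : 'I_3) : cmx R 3 3 := (0, delta_mx i i - delta_mx j j).

End Generators.

Ltac lie_delta :=
  rewrite /lie /cmul /cadd /cneg /cscale /matE /matiE /matH /matiH /czero /=;
  rewrite ?(mulmx0, mul0mx, mulmxDl, mulmxDr, mulmxBl, mulmxBr);
  rewrite ?(mulmxN, mulNmx) ?mul_delta_mx_cond ?eqxx;
  repeat match goal with
  | H : is_true (?i != ?j) |- _ =>
      rewrite ?[j == i]eq_sym ?(negPf H); clear H
  end;
  rewrite ?mulr1n ?mulr0n; congr pair; mx_ring.

Section Rep.
Variables (R : rcfType) (n' : nat).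
Local Notation n := n'.+1.
Variable rho : cmx R 3 3 -> 'M[R]_n.
Hypothesis rep : is_rep rho.
Local Notation matE := (matE R).
Local Notation matiE := (matiE R).
Local Notation matH := (matH R).
Local Notation matiH := (matiH R).

(** The actions of E_ij, i E_ij, E_ii - E_jj and i (E_ii - E_jj) are kept as four families, since
    [rho] is only real linear. *)
Definition rE i j := rho (matE i j).
Definition rF i j := rho (matiE i j).
Definition rH i j := rho (matH i j).
Definition rG i j := rho (matiH i j).
Local Notation X := rE.
Local Notation Y := rF.
Local Notation H := rH.
Local Notation G := rG.

Lemma trace_delta (i j : 'I_3) : \tr (delta_mx i j : 'M[R]_3) = (i == j)%:R.
Proof.
rewrite /mxtrace (bigD1 i) //= !mxE eqxx big1 ?addr0 // => k /negPf ki.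
by rewrite !mxE ki.
Qed.

Lemma sl3_matE i j : i != j -> sl3 (matE i j).
Proof. by move=> /negPf ij; split; rewrite /= ?trace_delta ?ij ?raddf0. Qed.
Lemma sl3_matiE i j : i != j -> sl3 (matiE i j).
Proof. by move=> /negPf ij; split; rewrite /= ?trace_delta ?ij ?raddf0. Qed.
Lemma sl3_matH i j : sl3 (matH i j).
Proof. by split; rewrite /= ?raddf0 // raddfB /= !trace_delta !eqxx subrr. Qed.
Lemma sl3_matiH i j : sl3 (matiH i j).
Proof. by split; rewrite /= ?raddf0 // raddfB /= !trace_delta !eqxx subrr. Qed.
Lemma sl3_0 : sl3 (czero R 3 3).
Proof. by split; rewrite /= raddf0. Qed.

Lemma sl3_scale a (A : cmx R 3 3) : sl3 A -> sl3 (cscale a A).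
Proof. by case=> a1 a2; split; rewrite /= mxtraceZ ?a1 ?a2 mulr0. Qed.
Lemma sl3_add (A B : cmx R 3 3) : sl3 A -> sl3 B -> sl3 (cadd A B).
Proof. by case=> a1 a2 [b1 b2]; split; rewrite /= raddfD /= ?a1 ?a2 ?b1 ?b2 addr0. Qed.

Lemma rho0 : rho (czero R 3 3) = 0.
Proof.
case: rep => /(_ 1 _ _ sl3_0 sl3_0) + _.
have -> : cadd (cscale 1 (czero R 3 3)) (czero R 3 3) = czero R 3 3.
  by rewrite /cadd /= !scaler0 addr0.
by rewrite scale1r => /eqP; rewrite -subr_eq subrr eq_sym => /eqP.
Qed.

Lemma rhoD A B : sl3 A -> sl3 B -> rho (cadd A B) = rho A + rho B.
Proof.
case: rep => + _ a b; move/(_ 1 _ _ a b); rewrite scale1r => <-.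
by congr rho; rewrite /cadd /= !scale1r.
Qed.

Lemma rhoZ x A : sl3 A -> rho (cscale x A) = x *: rho A.
Proof.
case: rep => + _ a; move/(_ x _ _ a sl3_0); rewrite rho0 addr0 => <-.
by congr rho; rewrite /cadd /= !addr0.
Qed.

(** Brackets are stated as rules that move one operator to the right past another, towards a vector
    that it kills. *)
Lemma rho_bracket A B C : sl3 A -> sl3 B -> lie A B = C ->
  rho A *m rho B = rho B *m rho A + rho C.
Proof. by case: rep => _ rl a b <-; rewrite rl // addrC subrK. Qed.

Lemma rho_bracketZ A B C x : sl3 A -> sl3 B -> sl3 C -> lie A B = cscale x C ->
  rho A *m rho B = rho B *m rho A + x *: rho C.
Proof. by move=> a b c AB; rewrite -rhoZ //; apply: rho_bracket. Qed.

Lemma rho_comm A B : sl3 A -> sl3 B -> lie A B = czero R 3 3 ->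
  rho A *m rho B = rho B *m rho A.
Proof. by move=> a b AB; rewrite (rho_bracket a b AB) rho0 addr0. Qed.

Ltac sl3_tac := by first [apply: sl3_matH | apply: sl3_matiH
  | apply: sl3_matE; rewrite // eq_sym | apply: sl3_matiE; rewrite // eq_sym].

Ltac bracket := intros;
  first [apply: rho_comm | apply: rho_bracket | apply: rho_bracketZ];
  try sl3_tac; lie_delta.

Lemma rE_rE_opp i j : i != j -> X i j *m X j i = X j i *m X i j + H i j.
Proof. bracket. Qed.
Lemma rE_rF_opp i j : i != j -> X i j *m Y j i = Y j i *m X i j + G i j.
Proof. bracket. Qed.
Lemma rF_rE_opp i j : i != j -> Y i j *m X j i = X j i *m Y i j + G i j.
Proof. bracket. Qed.
Lemma rE_rE_chain i j k : i != j -> j != k -> i != k -> X i j *m X j k = X j k *m X i j + X i k.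
Proof. bracket. Qed.
Lemma rE_rF_chain i j k : i != j -> j != k -> i != k -> X i j *m Y j k = Y j k *m X i j + Y i k.
Proof. bracket. Qed.
Lemma rF_rE_chain i j k : i != j -> j != k -> i != k -> Y i j *m X j k = X j k *m Y i j + Y i k.
Proof. bracket. Qed.

Lemma rF_rF_opp i j : i != j -> Y i j *m Y j i = Y j i *m Y i j + (-1) *: H i j.
Proof. bracket. Qed.
Lemma rF_rF_chain i j k : i != j -> j != k -> i != k ->
  Y i j *m Y j k = Y j k *m Y i j + (-1) *: X i k.
Proof. bracket. Qed.
Lemma rE_rE_comm i j k l : i != j -> k != l -> j != k -> i != l ->
  X i j *m X k l = X k l *m X i j.
Proof. bracket. Qed.
Lemma rE_rF_comm i j k l : i != j -> k != l -> j != k -> i != l ->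
  X i j *m Y k l = Y k l *m X i j.
Proof. bracket. Qed.
Lemma rF_rF_comm i j k l : i != j -> k != l -> j != k -> i != l ->
  Y i j *m Y k l = Y k l *m Y i j.
Proof. bracket. Qed.
Lemma rH_comm i j k l : H i j *m H k l = H k l *m H i j.
Proof.
apply: rho_comm; try sl3_tac.
rewrite /lie /cmul /cadd /cneg /matH /= !mulmx0 !mul0mx !subr0 !addr0 oppr0.
suff d (a b : 'I_3) : (delta_mx a a : 'M[R]_3) *m delta_mx b b = delta_mx b b *m delta_mx a a.
  by rewrite !(mulmxBl, mulmxBr) ?(d k) ?(d l); congr pair; rewrite ?addr0 //; mx_ring.
rewrite !mul_delta_mx_cond; by case: eqVneq => [->|].
Qed.
Lemma rG_rF i j : i != j -> G i j *m Y i j = Y i j *m G i j + (- 2) *: X i j.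
Proof. bracket. Qed.

Definition root_wt (i j k : 'I_3) : R := (k == i)%:R - (k == j)%:R.

Lemma rH_rE i j k l : i != j ->
  H k l *m X i j = X i j *m H k l + (root_wt i j k - root_wt i j l) *: X i j.
Proof.
move=> ij; apply: rho_bracketZ; try sl3_tac; rewrite /root_wt.
case: (eqVneq k i) => [?|ki]; case: (eqVneq k j) => [?|kj];
case: (eqVneq l i) => [?|li]; case: (eqVneq l j) => [?|lj]; subst;
  try (by move: ij; rewrite eqxx); lie_delta.
Qed.
Lemma rH_rF i j k l : i != j ->
  H k l *m Y i j = Y i j *m H k l + (root_wt i j k - root_wt i j l) *: Y i j.
Proof.
move=> ij; apply: rho_bracketZ; try sl3_tac; rewrite /root_wt.
case: (eqVneq k i) => [?|ki]; case: (eqVneq k j) => [?|kj];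
case: (eqVneq l i) => [?|li]; case: (eqVneq l j) => [?|lj]; subst;
  try (by move: ij; rewrite eqxx); lie_delta.
Qed.
End Rep.

Section Weights.
Variables (R : rcfType) (n' : nat).
Local Notation n := n'.+1.
Variable rho : cmx R 3 3 -> 'M[R]_n.
Hypothesis rep : is_rep rho.
Local Notation X := (rE rho).
Local Notation Y := (rF rho).
Local Notation H := (rH rho).
Local Notation G := (rG rho).
Implicit Types (c d : 'I_3 -> R) (u v : 'cV[R]_n).

(* The H_ij only see the differences c i - c j, so weights are taken up to an
   additive constant. *)
Definition wt c v := forall i j, H i j *m v = (c i - c j) *: v.
Definition weq c d := [forall i, forall j, c i - c j == d i - d j].
Definition is_weight c := exists2 v, v != 0 & wt c v.

Lemma weqP c d : reflect (forall i j, c i - c j = d i - d j) (weq c d).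
Proof.
by apply: (iffP forallP) => cd i; [move=> j; apply/eqP/(forallP (cd i))|apply/forallP => j; rewrite cd].
Qed.

Lemma weq_sym c d : weq c d = weq d c.
Proof. by apply/weqP/weqP => cd i j; rewrite cd. Qed.
Lemma weq_trans c d e : weq c d -> weq d e -> weq c e.
Proof. by move=> /weqP cd /weqP de; apply/weqP => i j; rewrite cd de. Qed.

Lemma wt_weq c d v : weq c d -> wt c v -> wt d v.
Proof. by move=> /weqP cd cv i j; rewrite cv cd. Qed.

Lemma is_weight_weq c d : weq c d -> is_weight c -> is_weight d.
Proof. by move=> cd [v v0 cv]; exists v => //; apply: wt_weq cv. Qed.

Lemma wt_unique c d v : wt c v -> wt d v -> v != 0 -> weq c d.
Proof.
move=> cv dv v0; apply/weqP => i j; apply/eqP; rewrite -subr_eq0.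
have /eqP : (c i - c j) *: v = (d i - d j) *: v by rewrite -cv -dv.
by rewrite -subr_eq0 -scalerBl scaler_eq0 (negPf v0) orbF.
Qed.

Lemma wt0 c : wt c 0.
Proof. by move=> i j; rewrite mulmx0 scaler0. Qed.

Lemma wtD c u v : wt c u -> wt c v -> wt c (u + v).
Proof. by move=> cu cv i j; rewrite mulmxDr cu cv scalerDr. Qed.

Lemma wtZ c a v : wt c v -> wt c (a *: v).
Proof. by move=> cv i j; rewrite -scalemxAr cv !scalerA mulrC. Qed.

Lemma wt_rE i j c v : i != j -> wt c v -> wt (fun k => c k + root_wt R i j k) (X i j *m v).
Proof.
move=> ij cv k l; rewrite mulmxA rH_rE // mulmxDl -mulmxA cv -scalemxAr -scalemxAl -scalerDl.
by congr (_ *: _) => /=; ring.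
Qed.

Lemma wt_rF i j c v : i != j -> wt c v -> wt (fun k => c k + root_wt R i j k) (Y i j *m v).
Proof.
move=> ij cv k l; rewrite mulmxA rH_rF // mulmxDl -mulmxA cv -scalemxAr -scalemxAl -scalerDl.
by congr (_ *: _) => /=; ring.
Qed.

(** G_ij is the commutator of E_ij and i E_ji, whose shifts of the weight are opposite. *)
Lemma wt_rG i j c v : i != j -> wt c v -> wt c (G i j *m v).
Proof.
move=> ij cv k l.
have -> : G i j *m v = X i j *m (Y j i *m v) - Y j i *m (X i j *m v).
  by rewrite !mulmxA rE_rF_opp // mulmxDl addrC addKr.
have ji : j != i by rewrite eq_sym.
have a : wt c (X i j *m (Y j i *m v)).
  apply: wt_weq (wt_rE ij (wt_rF ji cv)); apply/weqP => x y.
  by rewrite /root_wt; ring.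
have b : wt c (Y j i *m (X i j *m v)).
  apply: wt_weq (wt_rF ji (wt_rE ij cv)); apply/weqP => x y.
  by rewrite /root_wt; ring.
by rewrite -scaleN1r; apply: wtD => //; apply: wtZ.
Qed.

Lemma wt_notweight c v : ~ is_weight c -> wt c v -> v = 0.
Proof. by move=> cn cv; apply/eqP/negPn/negP => v0; apply: cn; exists v. Qed.

Lemma tripleE i j : i != j -> sl2_triple (X i j) (X j i) (H i j).
Proof.
move=> ij; have ji : j != i by rewrite eq_sym.
split; first exact: rE_rE_opp.
- rewrite rH_rE // /root_wt !eqxx (negPf ij) (negPf ji); congr (_ + _ *: _) => /=; ring.
- rewrite rH_rE // /root_wt !eqxx (negPf ij) (negPf ji) -scaleNr; congr (_ + _ *: _) => /=; ring.
Qed.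

(** Since [i E_ij, i E_ji] = - H_ij, the lowering operator must be - i E_ji for the triple to have
    the same H_ij. *)
Lemma tripleF i j : i != j -> sl2_triple (Y i j) (- Y j i) (H i j).
Proof.
move=> ij; have ji : j != i by rewrite eq_sym.
split.
- by rewrite mulmxN mulNmx rF_rF_opp // scaleN1r opprD opprK.
- rewrite rH_rF // /root_wt !eqxx (negPf ij) (negPf ji); congr (_ + _ *: _) => /=; ring.
- rewrite mulmxN mulNmx rH_rF // /root_wt !eqxx (negPf ij) (negPf ji) opprD; congr (_ + _).
  by rewrite scalerN -!scaleNr; congr (_ *: _) => /=; ring.
Qed.

Lemma lowerE_inj i j c v : i != j -> c i - c j >= 1 -> wt c v -> X j i *m v = 0 -> v = 0.
Proof.
move=> ij cij cv Xv.
have [N [eN _]] := sl2_nilpotent (tripleE ij).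
apply: (@sl2_lowering_inj _ _ _ _ _ (tripleE ij) _ v (c i - c j) 1 N) => //.
by rewrite eN mul0mx.
Qed.

Lemma lowerF_inj i j c v : i != j -> c i - c j >= 1 -> wt c v -> Y j i *m v = 0 -> v = 0.
Proof.
move=> ij cij cv Yv.
have [N [eN _]] := sl2_nilpotent (tripleF ij).
apply: (@sl2_lowering_inj _ _ _ _ _ (tripleF ij) _ v (c i - c j) 1 N) => //.
  by rewrite mulNmx Yv oppr0.
by rewrite eN mul0mx.
Qed.

Lemma weight_int c i j : is_weight c -> exists k : int, c i - c j = k%:~R.
Proof.
move=> [v v0 cv].
have [<-|ij] := eqVneq i j; first by exists 0; rewrite subrr.
have [s _ sP] := sl2_diagonalizable (tripleE ij).
have hp (p : {poly R}) : horner_mx (H i j) p *m v = p.[c i - c j] *: v.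
  elim/poly_ind: p => [|p a IHp]; first by rewrite rmorph0 horner0 mul0mx scale0r.
  rewrite hornerMXaddC rmorphD rmorphM /= horner_mx_X horner_mx_C -mulmxE mulmxDl.
  by rewrite -mulmxA cv -scalemxAr IHp mul_scalar_mx scalerA scalerDl mulrC.
have /eqP := hp (\prod_(x <- s) ('X - (x%:~R)%:P)).
rewrite sP mul0mx eq_sym scaler_eq0 (negPf v0) orbF horner_prod prodf_seq_eq0.
by case/hasP => x _ /=; rewrite hornerXsubC subr_eq0 => /eqP ->; exists x.
Qed.

Definition swap c i j : 'I_3 -> R :=
  fun k => if k == i then c j else if k == j then c i else c k.

(** A reflection of the Weyl group. For the integer k = c i - c j >= 0, the vector E_ji^k v has the
    swapped weight, and it is nonzero because f^k is injective on vectors of eigenvalue k. *)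
Lemma weight_swap c i j : is_weight c -> is_weight (swap c i j).
Proof.
wlog ci : i j / c j <= c i.
  move=> wl cw; have [/wl|/ltW/wl] := leP (c j) (c i); first exact.
  move=> /(_ cw) sw; apply: is_weight_weq sw; apply/weqP => x y; rewrite /swap.
  by case: (eqVneq x i) (eqVneq x j) (eqVneq y i) (eqVneq y j) 
     => [?|?] [?|?] [?|?] [?|?]; subst; rewrite ?eqxx.
have [<-|ij] := eqVneq i j.
  move=> cw; apply: is_weight_weq cw; apply/weqP => x y; rewrite /swap.
  by case: (eqVneq x i) (eqVneq y i) => [?|?] [?|?]; subst.
move=> cw; have [k kE] := weight_int i j cw; case: (cw) => v v0 cv.
have : (0 <= k) by rewrite -(ler0z R) -kE subr_ge0.
case: k kE => // k kE _.
have lower r : wt (fun x => c x + r%:R * root_wt R j i x) (X j i ^+ r *m v).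
  elim: r => [|r IH].
    by rewrite expr0 mul1mx; apply: wt_weq cv; apply/weqP => x y; ring.
  rewrite exprS -mulmxE -mulmxA; have ji : j != i by rewrite eq_sym.
  apply: wt_weq (wt_rE ji IH); apply/weqP => x y.
  by rewrite -[r.+1%:R]natr1; ring.
exists (X j i ^+ k *m v); last first.
  apply: wt_weq (lower k); apply/weqP => x y; rewrite /swap /root_wt.
  have kE' : k%:R = c i - c j by rewrite kE.
  rewrite kE'; case: (eqVneq x i) (eqVneq x j) (eqVneq y i) (eqVneq y j)
     => [?|?] [?|?] [?|?] [?|?]; subst; rewrite ?eqxx //; try (by move: ij; rewrite eqxx); rewrite /=; ring.
apply: contraNneq v0 => Xv.
have [N [eN _]] := sl2_nilpotent (tripleE ij).
apply/eqP/(@sl2_lowering_inj _ _ _ _ _ (tripleE ij) _ v (c i - c j) k N) => //.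
  by rewrite kE.
by rewrite eN mul0mx.
Qed.
End Weights.

Section WeightBasis.
Variables (R : rcfType) (n' : nat).
Local Notation n := n'.+1.
Variable rho : cmx R 3 3 -> 'M[R]_n.
Hypothesis rep : is_rep rho.
Local Notation H := (rH rho).
Local Notation wt := (wt rho).
Implicit Types (c d : 'I_3 -> R) (u v : 'cV[R]_n).

Lemma rH_add i j k : H i j + H j k = H i k.
Proof.
rewrite /rH -rhoD //; try exact: sl3_matH; congr rho.
by rewrite /cadd /matH /= addr0 addrA subrK.
Qed.

Lemma rH_diag i : H i i = 0.
Proof. by apply/eqP; rewrite -(inj_eq (addrI (H i i))) rH_add addr0. Qed.

Lemma diagonalizable_H i j : diagonalizable (H i j).
Proof.
have [->|ij] := eqVneq i j; first by rewrite rH_diag; exact: diagonalizable0.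
have [s us sP] := sl2_diagonalizable (tripleE rep ij).
apply/diagonalizableP; exists [seq x%:~R | x <- s].
  by rewrite map_inj_uniq //; exact: intr_inj.
by rewrite big_map; apply: mxminpoly_min.
Qed.

(** The operators H_k0 commute and are diagonalizable, so they have a common eigenbasis: [t]
    consists of the columns of P^-1 and the coordinate functionals [a] of the rows of P. Every other
    H_kl is a difference of two of them. *)
Lemma weight_basis : exists (t : 'I_n -> 'cV[R]_n) (c : 'I_n -> 'I_3 -> R)
    (a : 'I_n -> 'rV[R]_n),
  [/\ forall i, wt (c i) (t i), forall i, t i != 0,
      forall v, v = \sum_i (a i *m v) 0 0 *: t i &
      forall v d i, wt d v -> (a i *m v) 0 0 != 0 -> weq d (c i)].
Proof.
have [P Pu /allP PH] : codiagonalizable [seq H k ord0 | k <- enum 'I_3].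
  apply/codiagonalizableP; split => [A B /mapP[k _ ->] /mapP[l _ ->]|A /mapP[k _ ->]].
    exact: rH_comm.
  exact: diagonalizable_H.
have /fin_all_exists[D DE] k : exists D : 'rV[R]_n, P *m H k ord0 = diag_mx D *m P.
  have /PH/diagonalizable_forPex[D /(simmxP Pu) DE] :
      H k ord0 \in [seq H k ord0 | k <- enum 'I_3] by apply/mapP; exists k; rewrite ?mem_enum.
  by exists D.
have HE k l v : H k l *m v = H k ord0 *m v - H l ord0 *m v.
  by rewrite -mulmxBl -(rH_add k l ord0) addrK.
have dD (d : 'rV[R]_n) i : diag_mx d *m delta_mx i 0 = d 0 i *: delta_mx i 0 :> 'cV_n.
  apply/matrixP => x y; rewrite mul_diag_mx !mxE.
  by case: eqVneq => [->|]; rewrite ?mulr0.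
have dD' (d : 'rV[R]_n) i : delta_mx 0 i *m diag_mx d = d 0 i *: delta_mx 0 i :> 'rV_n.
  apply/matrixP => x y; rewrite mul_mx_diag !mxE.
  by case: (eqVneq y i) => [->|]; rewrite ?andbF ?mul0r ?mulr0 // mulrC.
exists (fun i => invmx P *m delta_mx i 0), (fun i k => D k 0 i), (fun i => delta_mx 0 i *m P).
split.
- move=> i k l; rewrite HE !mulmxA.
  have PE m : H m ord0 *m invmx P = invmx P *m diag_mx (D m).
    by rewrite -[LHS](mulKmx Pu) (mulmxA P) DE -mulmxA mulmxV // mulmx1.
  by rewrite !PE -!mulmxA !dD -!scalemxAr -scalerBl.
- move=> i; apply/eqP => /(congr1 (mulmx P)); rewrite mulKVmx // mulmx0.
  by move/matrixP/(_ i 0)/eqP; rewrite !mxE !eqxx oner_eq0.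
- move=> v; rewrite -{1}[v](mulKmx Pu); set w := P *m v.
  have wE : w = \sum_i w i 0 *: delta_mx i 0.
    by rewrite [LHS]matrix_sum_delta; apply: eq_bigr => i _; rewrite big_ord1.
  rewrite [in LHS]wE mulmx_sumr; apply: eq_bigr => i _; rewrite -scalemxAr.
  by congr (_ *: _); rewrite -mulmxA -/w -rowE [RHS]mxE.
- move=> v d i dv a0.
  have dk k : d k - d ord0 = D k 0 i.
    have : delta_mx 0 i *m P *m (H k ord0 *m v) = D k 0 i *: (delta_mx 0 i *m P *m v) :> 'M_1.
      by rewrite [LHS]mulmxA -(mulmxA _ P) DE mulmxA dD' -!scalemxAl.
    rewrite dv -scalemxAr => /matrixP/(_ 0 0); rewrite [LHS]mxE [RHS]mxE.
    exact: mulIf.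
  by apply/weqP => k l; rewrite -!dk; ring.
Qed.

End WeightBasis.

(** * The weights of W *)

Lemma I3_cover (i j k : 'I_3) : i != j -> j != k -> i != k ->
  forall x, [|| x == i, x == j | x == k].
Proof.
by move=> ij jk ik x; move: i j k x ij jk ik; do 4![case=> [[|[|[|?]]] ?] //].
Qed.

Lemma I3_third (i j : 'I_3) : i != j -> exists k, j != k /\ i != k.
Proof.
move: i j; do 2![case=> [[|[|[|?]]] ?] //] => _;
 solve [by exists (Ordinal (isT : 0 < 3)%N)|by exists (Ordinal (isT : 1 < 3)%N)
       |by exists (Ordinal (isT : 2 < 3)%N)].
Qed.

Lemma I3_others (i : 'I_3) : exists j k, [/\ i != j, j != k & i != k].
Proof.
have [j ij] : exists j, i != j.
  by case: i => [[|i] ?]; [exists (Ordinal (isT : 1 < 3)%N)|exists ord0].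
by have [k [jk ik]] := I3_third ij; exists j, k.
Qed.

Lemma sum_I3 (V : nmodType) (i j k : 'I_3) (F : 'I_3 -> V) :
  i != j -> j != k -> i != k -> \sum_x F x = F i + F j + F k.
Proof.
move=> ij jk ik; rewrite (bigD1 i) //= (bigD1 j) 1?eq_sym //= (bigD1 k) /=.
  rewrite big1 ?addr0 ?addrA // => x /andP[/andP[xi xj] xk].
  by have := I3_cover ij jk ik x; rewrite (negPf xi) (negPf xj) (negPf xk).
by rewrite [k == i]eq_sym [k == j]eq_sym ik jk.
Qed.

Section Norm.
Variable R : rcfType.
Implicit Types (c d : 'I_3 -> R).

(* Proportional to the Killing norm of the weight c. *)
Definition wnorm c : R := \sum_i \sum_j (c i - c j) ^+ 2.

Lemma wnormE i j k c : i != j -> j != k -> i != k ->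
  wnorm c = 2 * ((c i - c j) ^+ 2 + (c j - c k) ^+ 2 + (c i - c k) ^+ 2).
Proof. by move=> ij jk ik; rewrite /wnorm !(sum_I3 _ ij jk ik); ring. Qed.

Lemma wnorm_weq c d : weq c d -> wnorm c = wnorm d.
Proof.
by move=> /weqP cd; rewrite /wnorm; apply: eq_bigr => i _; apply: eq_bigr => j _; rewrite cd.
Qed.

(* x times the i-th coordinate weight e_i. *)
Definition eps (x : R) (i : 'I_3) : 'I_3 -> R := fun k => x * (k == i)%:R.

Lemma weqI3 i j k c d : i != j -> j != k -> i != k ->
  c i - c j = d i - d j -> c j - c k = d j - d k -> weq c d.
Proof.
move=> ij jk ik e1 e2; apply/weqP => x y.
have e3 z : c z - c j = d z - d j.
  have := I3_cover ij jk ik z; case/or3P => /eqP ->; rewrite ?e1 ?subrr //.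
  by rewrite -opprB e2 opprB.
by rewrite -[LHS](subrKA (c j)) -[c j - _]opprB !e3; ring.
Qed.
End Norm.

Section Wedge.
Variables (R : rcfType) (n' : nat).
Local Notation n := n'.+1.
Variable rho : cmx R 3 3 -> 'M[R]_n.
Hypothesis rep : is_rep rho.
Local Notation H := (rH rho).
Local Notation X := (rE rho).
Local Notation Y := (rF rho).
Local Notation G := (rG rho).
Local Notation wt := (wt rho).
Local Notation is_weight := (is_weight rho).
Implicit Types (c d : 'I_3 -> R) (u v : 'cV[R]_n).

Definition indep u v := forall a b : R, a *: u + b *: v = 0 -> a = 0 /\ b = 0.

Lemma collinear_or_indep u v : v != 0 -> (exists r, u = r *: v) \/ indep u v.
Proof.
move=> v0; have [/sub_rVP[r uv]|uv] := boolP (u^T <= v^T)%MS.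
  by left; exists r; rewrite -[u]trmxK uv linearZ /= trmxK.
right=> a b ab.
have a0 : a = 0.
  apply/eqP/negPn/negP => a0; case/negP: uv; apply/sub_rVP; exists (- (a^-1 * b)).
  rewrite -linearZ /=; congr trmx; apply: (scalerI a0).
  rewrite scaleNr scalerN scalerA mulrA mulfV // mul1r; apply/eqP.
  by rewrite -addr_eq0 ab.
split=> //; move: ab; rewrite a0 scale0r add0r => /eqP.
by rewrite scaler_eq0 (negPf v0) orbF => /eqP.
Qed.

Lemma indep_weights c d u v : wt c u -> wt d v -> u != 0 -> v != 0 ->
  ~~ weq c d -> indep u v.
Proof.
move=> cu dv u0 v0 cd; have [[r uv]|//] := collinear_or_indep u v0.
case/negP: cd; apply: (wt_unique cu) => //.
by rewrite uv; apply: wtZ.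
Qed.

(** Applying E_ji and i E_ji to a relation a E_ij v + b (i E_ij) v = 0 gives a x v + b G v = 0 and a
    G v - b x v = 0. The unknown vector G v is eliminated by forming (a^2 + b^2) x v = 0, and over
    an ordered field a = b = 0. *)
Lemma rE_rF_indep i j v x : i != j -> X j i *m v = 0 -> Y j i *m v = 0 ->
  H j i *m v = x *: v -> x != 0 -> v != 0 -> indep (X i j *m v) (Y i j *m v).
Proof.
move=> ij Xv Yv Hv x0 v0 a b ab; have ji : j != i by rewrite eq_sym.
have e1 : (a * x) *: v + b *: (G j i *m v) = 0.
  move/(congr1 (mulmx (X j i))): ab.
  rewrite mulmx0 mulmxDr -!scalemxAr !mulmxA rE_rE_opp // rE_rF_opp // !mulmxDl -!mulmxA Xv Hv.
  by rewrite !mulmx0 !add0r scalerA.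
have e2 : a *: (G j i *m v) - (b * x) *: v = 0.
  move/(congr1 (mulmx (Y j i))): ab.
  rewrite mulmx0 mulmxDr -!scalemxAr !mulmxA rF_rE_opp // rF_rF_opp // !mulmxDl -!mulmxA Yv.
  by rewrite -scalemxAl Hv !mulmx0 !add0r scaleN1r scalerN scalerA.
have : ((a ^+ 2 + b ^+ 2) * x) *: v = 0.
  have -> : ((a ^+ 2 + b ^+ 2) * x) *: v =
    a *: ((a * x) *: v + b *: (G j i *m v)) - b *: (a *: (G j i *m v) - (b * x) *: v).
    by rewrite !(scalerDr, scalerN, scalerA); mx_ring.
  by rewrite e1 e2 !scaler0 subrr.
move/eqP; rewrite scaler_eq0 (negPf v0) mulf_eq0 (negPf x0) !orbF.
by rewrite paddr_eq0 ?sqr_ge0 // !sqrf_eq0 => /andP[/eqP -> /eqP ->].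
Qed.

(** Up to a constant every weight is one of the finitely many weights of the basis. *)
Lemma max_weight : exists2 c, is_weight c & forall d, is_weight d -> wnorm d <= wnorm c.
Proof.
have [t [c [a [ct t0 vE matE]]]] := weight_basis rep.
case: (@arg_maxP _ _ _ (@ord0 n') xpredT (fun i => wnorm (c i)) isT) => m _ mP.
exists (c m); first by exists (t m).
move=> d [v v0 dv].
have [i ai] : exists i, (a i *m v) 0 0 != 0.
  apply/existsP; apply: contraNT v0 => /existsPn a0; apply/eqP; rewrite (vE v) big1 // => i _.
  by have := a0 i; rewrite negbK => /eqP ->; rewrite scale0r.
by rewrite (wnorm_weq (matE _ _ _ dv ai)); apply: mP.
Qed.

(** [pr c] sums the coordinates along the basis vectors of weight c. Weights being functions up to a
    constant, the projections over a list add up to the identity when it contains exactly one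
    representative of each weight. *)
Lemma weight_projections : exists pr : ('I_3 -> R) -> 'cV[R]_n -> 'cV[R]_n,
  [/\ forall c u v, pr c (u + v) = pr c u + pr c v,
      forall c v, wt c (pr c v),
      forall c v, wt c v -> pr c v = v,
      forall c d v, ~~ weq c d -> wt d v -> pr c v = 0 &
      forall L, (forall d, is_weight d -> count (fun c => weq c d) L = 1%N) ->
        forall v, v = \sum_(c <- L) pr c v].
Proof.
have [t [c [a [ct t0 vE matE]]]] := weight_basis rep.
exists (fun d v => \sum_(i | weq d (c i)) (a i *m v) 0 0 *: t i); split.
- move=> d u v; rewrite -big_split; apply: eq_bigr => i _ /=.
  by rewrite mulmxDr mxE scalerDl.
- move=> d v; apply: (big_ind (wt d)) => [|? ?|i di]; [exact: wt0|exact: wtD|].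
  by apply/wtZ/(wt_weq _ (ct i)); rewrite weq_sym.
- move=> d v dv; rewrite [RHS]vE big_mkcond; apply: eq_bigr => i _ /=.
  case: ifPn => // di; have [->|ai] := eqVneq ((a i *m v) 0 0) 0; first by rewrite scale0r.
  by rewrite (matE _ _ _ dv ai) in di.
- move=> d d' v dd' dv; rewrite big1 // => i di.
  have [->|ai] := eqVneq ((a i *m v) 0 0) 0; first by rewrite scale0r.
  by case/negP: dd'; apply: (weq_trans di); rewrite weq_sym; apply: matE dv ai.
- move=> L LP v; rewrite (exchange_big_dep xpredT) //= [LHS]vE; apply: eq_bigr => i _.
  by rewrite big_const_seq (LP (c i)) /= ?addr0 //; exists (t i).
Qed.

Variable w : 'cV[R]_n -> 'cV[R]_n -> 'rV[R]_n.
Hypotheses (wbil : sym_bilinear w) (weqv : equivariant rho w) (wnd : nondeg2 w).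

Lemma wedgeDl u v x : w (u + v) x = w u x + w v x.
Proof. by case: wbil => + _; move/(_ 1 u v x); rewrite !scale1r. Qed.

Lemma wedge0l x : w 0 x = 0.
Proof. by apply: (addrI (w 0 x)); rewrite -wedgeDl !addr0. Qed.

Lemma wedgeZl a u x : w (a *: u) x = a *: w u x.
Proof. by case: wbil => + _; move/(_ a u 0 x); rewrite wedge0l !addr0. Qed.

Lemma wedgeC u v : w u v = w v u.
Proof. by case: wbil. Qed.

Lemma wedgeDr u v x : w x (u + v) = w x u + w x v.
Proof. by rewrite wedgeC wedgeDl !(wedgeC x). Qed.

Lemma wedgeZr a u x : w x (a *: u) = a *: w x u.
Proof. by rewrite wedgeC wedgeZl wedgeC. Qed.

(** By equivariance the functional u ^ v has weight c + d for the dual action. Some vector of the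
    weight basis is not killed by it, and that vector must have the opposite weight. *)
Lemma wedge_weight c d u v : wt c u -> wt d v -> w u v != 0 ->
  is_weight (fun k => - (c k + d k)).
Proof.
move=> cu dv uv0.
have [t [e [a [et t0 vE eE]]]] := weight_basis rep.
have [i wi] : exists i, w u v *m t i != 0.
  apply/existsP; apply: contraNT uv0 => /existsPn w0; apply/eqP.
  apply/trmx_inj/matrixP => x y; rewrite !ord1.
  have : w u v *m (delta_mx x 0 : 'cV[R]_n) = 0.
    rewrite (vE (delta_mx x 0)) mulmx_sumr big1 // => i _.
    by have := w0 i; rewrite negbK -scalemxAr => /eqP ->; rewrite scaler0.
  by rewrite -colE => /matrixP/(_ 0 0); rewrite !mxE.
apply: (@is_weight_weq _ _ _ (e i)); last by exists (t i).
apply/weqP => k l; apply/eqP; rewrite -subr_eq0.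
have := weqv u v (sl3_matH R k l) => /(congr1 (mulmx^~ (t i))).
rewrite -/(H k l) cu dv wedgeZl wedgeZr -scalerDl mulNmx -mulmxA et.
rewrite -scalemxAr -scalemxAl => /eqP; rewrite -subr_eq0 -opprD oppr_eq0 -scalerDl.
rewrite scaler_eq0 (negPf wi) orbF => /eqP <-; apply/eqP; ring.
Qed.

(** If u ^ u, u ^ v and v ^ v all vanished, the wedge would vanish on the plane spanned by u and
    v. *)
Lemma wedge_pair c d u v : wt c u -> wt d v -> indep u v ->
  [\/ is_weight (fun k => - (c k + c k)), is_weight (fun k => - (c k + d k)) |
      is_weight (fun k => - (d k + d k))].
Proof.
move=> cu dv /wnd [a [b [x [y]]]].
rewrite wedgeDl !wedgeDr !wedgeZl !wedgeZr (wedgeC v u) => nz.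
have [uu|/(wedge_weight cu cu)] := eqVneq (w u u) 0; last by constructor 1.
have [uv|/(wedge_weight cu dv)] := eqVneq (w u v) 0; last by constructor 2.
have [vv|/(wedge_weight dv dv)] := eqVneq (w v v) 0; last by constructor 3.
by case/negP: nz; rewrite uu uv vv !scaler0 !addr0.
Qed.

End Wedge.

Ltac simp_eq :=
  repeat match goal with
  | H : is_true (?i != ?j) |- _ => progress rewrite ?[j == i]eq_sym ?(negPf H)
  end; rewrite ?eqxx /=.

(** * The extremal weight *)

Section Classification.
Variables (R : rcfType) (n' : nat).
Local Notation n := n'.+1.
Variable rho : cmx R 3 3 -> 'M[R]_n.
Hypothesis rep : is_rep rho.
Local Notation H := (rH rho).
Local Notation X := (rE rho).
Local Notation Y := (rF rho).
Local Notation G := (rG rho).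
Local Notation wt := (wt rho).
Local Notation is_weight := (is_weight rho).
Implicit Types (c d : 'I_3 -> R) (u v : 'cV[R]_n).
Variable w : 'cV[R]_n -> 'cV[R]_n -> 'rV[R]_n.
Hypotheses (wbil : sym_bilinear w) (weqv : equivariant rho w) (wnd : nondeg2 w).

Lemma wnorm_dl (x : R) i : wnorm (eps x i) = 4 * x ^+ 2.
Proof.
have [j [k [ij jk ik]]] := I3_others i.
rewrite (wnormE _ ij jk ik) /eps; simp_eq; ring.
Qed.

Lemma wnorm_eq0 c i j : wnorm c = 0 -> c i = c j.
Proof.
move=> c0; apply/eqP; rewrite -subr_eq0 -sqrf_eq0; apply/eqP.
have ci : \sum_l (c i - c l) ^+ 2 = 0.
  by apply: (psumr_eq0P _ c0) => // k _; apply: sumr_ge0 => l _; apply: sqr_ge0.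
by apply: (psumr_eq0P _ ci) => // k _; apply: sqr_ge0.
Qed.

Lemma exists_extremal : faithful rho ->
  exists x i, [/\ x != 0, is_weight (eps x i) & forall d, is_weight d -> wnorm d <= 4 * x ^+ 2].
Proof.
move=> faith; have [c cw cmax] := max_weight rep.
(* If the largest norm were 0, all weights would vanish and H_01 would act as 0, against
   faithfulness. *)
have cpos : 0 < wnorm c.
  rewrite lt_neqAle andbC; apply/andP; split.
    by apply: sumr_ge0 => i _; apply: sumr_ge0 => j _; apply: sqr_ge0.
  apply/eqP => c0; pose i0 := @Ordinal 3 0 isT; pose i1 := @Ordinal 3 1 isT.
  have [t [e [a [et t0 vE eE]]]] := weight_basis rep.
  have Ht i : H i0 i1 *m t i = 0.
    rewrite et (_ : e i i0 - e i i1 = 0) ?scale0r //.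
    have e0 : wnorm (e i) = 0.
      apply/eqP; rewrite eq_le {1}c0 cmax /=; last by exists (t i).
      by apply: sumr_ge0 => x _; apply: sumr_ge0 => j _; apply: sqr_ge0.
    by rewrite (wnorm_eq0 i0 i1 e0) subrr.
  have H0 : H i0 i1 = 0.
    apply/matrixP => x y; have : H i0 i1 *m (delta_mx y 0 : 'cV[R]_n) = 0.
      by rewrite (vE (delta_mx y 0)) mulmx_sumr big1 // => i _; rewrite -scalemxAr Ht scaler0.
    by rewrite -colE => /matrixP/(_ x 0); rewrite !mxE.
  have : matH R i0 i1 = czero R 3 3.
    by apply: faith; [exact: sl3_matH|exact: sl3_0|rewrite rho0 //].
  case=> /matrixP/(_ i0 i0); rewrite !mxE /= => /eqP.
  by rewrite subr0 oner_eq0.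
(* The doubled weights have norm 4 |c|^2, too long, so -(c + swap c) is a weight. Its norm is at
   most that of c exactly when c k lies between c i and c j. *)
have opp i j k : i != j -> j != k -> i != k -> c i != c j -> (c j - c k) * (c i - c k) <= 0.
  move=> ij jk ik cij.
  have sw := weight_swap rep i j cw.
  have Nsw : wnorm (swap c i j) = wnorm c.
    rewrite !(wnormE _ ij jk ik) /swap; simp_eq; ring.
  case: (cw) (sw) => v v0 cv [u u0 su].
  have ncs : ~~ weq c (swap c i j).
    apply/negP => /weqP/(_ i j); rewrite /swap; simp_eq.
    move=> e; case/eqP: cij; lra.
  have := wedge_pair rep wbil weqv wnd cv su (indep_weights cv su v0 u0 ncs).
  have dbl d : wnorm d = wnorm c -> ~ is_weight (fun k => - (d k + d k)).
    have dd : wnorm (fun k => - (d k + d k)) = 4 * wnorm d.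
      by rewrite !(wnormE _ ij jk ik); ring.
    by move=> dc /cmax; rewrite dd dc; move: cpos; lra.
  case=> [/(dbl _ erefl) //|/cmax|/(dbl _ Nsw) //].
  rewrite !(wnormE _ ij jk ik) /swap; simp_eq; nra.
have [i [j [k [ij jk ik cjk]]]] : exists i j k, [/\ i != j, j != k, i != k & c j = c k].
  pose i0 := @Ordinal 3 0 isT; pose i1 := @Ordinal 3 1 isT; pose i2 := @Ordinal 3 2 isT.
  have [e|c01] := eqVneq (c i0) (c i1); first by exists i2, i0, i1.
  have [e|c12] := eqVneq (c i1) (c i2); first by exists i0, i1, i2.
  have [e|c02] := eqVneq (c i0) (c i2); first by exists i1, i0, i2.
  (* With three distinct coordinates each would lie between the other two: the three products add up
     to [wnorm c] / 4, which is positive. *)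
  have o1 := opp i0 i1 i2 isT isT isT c01.
  have o2 := opp i1 i2 i0 isT isT isT c12.
  have o3 := opp i0 i2 i1 isT isT isT c02.
  have E := wnormE c (isT : i0 != i1) (isT : i1 != i2) (isT : i0 != i2).
  by exfalso; move: cpos; rewrite E; nra.
have cdl : weq c (eps (c i - c j) i).
  apply: (weqI3 ij jk ik); rewrite /eps; simp_eq; rewrite ?cjk; ring.
exists (c i - c j), i; split.
- by apply: contraTneq cpos => e; rewrite (wnorm_weq cdl) wnorm_dl e expr0n /= mulr0 ltxx.
- exact: is_weight_weq cdl cw.
- by move=> d /cmax; rewrite (wnorm_weq cdl) wnorm_dl.
Qed.

Section Negative.
Variables (x : R) (i0 : 'I_3).
Hypotheses (x0 : 0 < x) (wx : is_weight (eps (- x) i0))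
  (wmax : forall d, is_weight d -> wnorm d <= 4 * x ^+ 2).

Lemma extremal_all i : is_weight (eps (- x) i).
Proof.
apply: is_weight_weq (weight_swap rep i0 i wx); apply/weqP => a b; rewrite /swap /eps.
have [<-|ii] := eqVneq i0 i.
  by case: (eqVneq a i0) (eqVneq b i0) => [?|?] [?|?]; subst; rewrite ?eqxx /=; ring.
by case: (eqVneq a i0) (eqVneq a i) (eqVneq b i0) (eqVneq b i)
    => [?|?] [?|?] [?|?] [?|?]; subst;
  try (by move: ii; rewrite eqxx); simp_eq; ring.
Qed.

(** For equal weights the three alternatives of [wedge_pair] coincide. In contrapositive form: if
    -2c is not a weight, the weight space of c is at most a line. *)
Lemma dim1_of_double c u v : wt c u -> wt c v -> indep u v -> is_weight (fun k => - (c k + c k)).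
Proof. by move=> cu cv /(wedge_pair rep wbil weqv wnd cu cv) []. Qed.

Lemma kill_rE i j c v : i != j -> wt c v -> 4 * x ^+ 2 < wnorm (fun k => c k + root_wt R i j k) ->
  X i j *m v = 0.
Proof.
move=> ij cv Nc; apply: (@wt_notweight _ _ rho _ _ _ (wt_rE rep ij cv)).
by move=> /wmax; rewrite leNgt Nc.
Qed.

Lemma kill_rF i j c v : i != j -> wt c v -> 4 * x ^+ 2 < wnorm (fun k => c k + root_wt R i j k) ->
  Y i j *m v = 0.
Proof.
move=> ij cv Nc; apply: (@wt_notweight _ _ rho _ _ _ (wt_rF rep ij cv)).
by move=> /wmax; rewrite leNgt Nc.
Qed.

Lemma extremal_coef : x = 2.
Proof.
have [j [k [ij jk ik]]] := I3_others i0.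
have ji : j != i0 by rewrite eq_sym.
have [v v0 cv] := wx.
(* Adding e_j - e_i0 to - x e_i0 lengthens it, so E_ji0 and i E_ji0 kill v, as [rE_rF_indep]
   requires. *)
have big : 4 * x ^+ 2 < wnorm (fun k => eps (- x) i0 k + root_wt R j i0 k).
  rewrite (wnormE _ ij jk ik) /eps /root_wt; simp_eq.
  rewrite [ltRHS](_ : _ = 4 * x ^+ 2 + 12 * x + 12); last by ring.
  by move: x0; lra.
have Hv : H j i0 *m v = x *: v.
  by rewrite cv /eps; simp_eq; congr (_ *: _); ring.
have ind := rE_rF_indep rep ij (kill_rE ji cv big) (kill_rF ji cv big) Hv (lt0r_neq0 x0) v0.
have := dim1_of_double (wt_rE rep ij cv) (wt_rF rep ij cv) ind => /wmax.
rewrite (wnormE _ ij jk ik) /eps /root_wt; simp_eq => le.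
(* The norm of -2c' is 16 x^2 - 48 x + 48, and bounding it by 4 x^2 means 12 (x - 2)^2 <= 0. *)
have : (x - 2) ^+ 2 <= 0 by move: le; lra.
by move=> le0; apply/eqP; rewrite -subr_eq0 -sqrf_eq0 eq_le le0 sqr_ge0.
Qed.
End Negative.
End Classification.

(** * Exclusion of all weights other than 0, e_i and -2 e_i *)

Section Tight.
Variables (R : rcfType) (n' : nat).
Local Notation n := n'.+1.
Variable rho : cmx R 3 3 -> 'M[R]_n.
Hypothesis rep : is_rep rho.
Local Notation H := (rH rho).
Local Notation X := (rE rho).
Local Notation Y := (rF rho).
Local Notation G := (rG rho).
Local Notation wt := (wt rho).
Local Notation is_weight := (is_weight rho).
Implicit Types (c d : 'I_3 -> R) (u v : 'cV[R]_n).
Variable w : 'cV[R]_n -> 'cV[R]_n -> 'rV[R]_n.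
Hypotheses (wbil : sym_bilinear w) (weqv : equivariant rho w) (wnd : nondeg2 w).
Hypotheses (wx : forall i, is_weight (eps (- 2) i))
  (wmax : forall d, is_weight d -> wnorm d <= 16).

(** Together with -2 e_j it would produce one of the weights -4 e_i, 2 (e_j - e_i), 4 e_j, of norms
    64, 48 and 64. *)
Lemma not_weight_2dl i : ~ is_weight (eps 2 i).
Proof.
case=> u u0 cu; have [j [k [ij jk ik]]] := I3_others i; have [v v0 cv] := wx j.
have nc : ~~ weq (eps 2 i) (eps (- 2 : R) j).
  apply/negP => /weqP/(_ i k); rewrite /eps; simp_eq => e.
  by move: e; lra.
have := wedge_pair rep wbil weqv wnd cu cv (indep_weights cu cv u0 v0 nc).
by case=> /wmax; rewrite (wnormE _ ij jk ik) /eps; simp_eq; lra.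
Qed.

(** By symmetry e_i - e_k would be a weight as well. The two doubled weights have norm 48, and minus
    the sum is -3 e_i up to a constant, of norm 36. *)
Lemma not_weight_root i j : i != j -> ~ is_weight (root_wt R i j).
Proof.
move=> ij ciw; have [k [jk ik]] := I3_third ij.
have [u u0 cu] := ciw.
have [v v0 cv] : is_weight (root_wt R i k).
  apply: is_weight_weq (weight_swap rep j k ciw); apply: (weqI3 ij jk ik);
    by rewrite /swap /root_wt; simp_eq; ring.
have nc : ~~ weq (root_wt R i j) (root_wt R i k).
  apply/negP => /weqP/(_ j k); rewrite /root_wt; simp_eq => e.
  by move: e; lra.
have := wedge_pair rep wbil weqv wnd cu cv (indep_weights cu cv u0 v0 nc).
by case=> /wmax; rewrite (wnormE _ ij jk ik) /root_wt; simp_eq; lra.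
Qed.

(** The weight e_j - 2 e_i has norm 28, so E_ji and i E_ji kill v. Then E_ij v and i E_ij v are
    independent of weight - e_j, and 2 e_j would be a weight, which is excluded. *)
Lemma not_weight_Ndl i : ~ is_weight (eps (- 1) i).
Proof.
case=> v v0 cv; have [j [k [ij jk ik]]] := I3_others i.
have ji : j != i by rewrite eq_sym.
have wX : X j i *m v = 0.
  apply: (@wt_notweight _ _ rho _ _ _ (wt_rE rep ji cv)) => /wmax.
  by rewrite (wnormE _ ij jk ik) /root_wt /eps; simp_eq; lra.
have wY : Y j i *m v = 0.
  apply: (@wt_notweight _ _ rho _ _ _ (wt_rF rep ji cv)) => /wmax.
  by rewrite (wnormE _ ij jk ik) /root_wt /eps; simp_eq; lra.
have Hv : H j i *m v = 1 *: v.
  by rewrite cv /eps; simp_eq; congr (_ *: _); ring.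
have ind := rE_rF_indep rep ij wX wY Hv (oner_neq0 _) v0.
have := dim1_of_double rep wbil weqv wnd (wt_rE rep ij cv) (wt_rF rep ij cv) ind.
move=> dw; apply: (@not_weight_2dl j); apply: is_weight_weq dw.
by apply: (weqI3 ij jk ik); rewrite /eps /root_wt; simp_eq; ring.
Qed.

Lemma top_collinear i u v : wt (eps (- 2) i) u -> wt (eps (- 2) i) v -> v != 0 ->
  exists r, u = r *: v.
Proof.
move=> cu cv v0; have [//|ind] := collinear_or_indep u v0.
have := dim1_of_double rep wbil weqv wnd cu cv ind => /wmax.
have [j [k [ij jk ik]]] := I3_others i.
by rewrite (wnormE _ ij jk ik) /eps; simp_eq; lra.
Qed.

(** The successive differences p, q of d are integers, and the bound 16 on the norm reads p^2 + q^2
    + (p + q)^2 <= 8. This leaves 0, the weights e_i, - e_i, 2 e_i, -2 e_i and the roots e_i - e_j;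
    three of these families have just been excluded. *)
Lemma weight_cases d : is_weight d ->
  [\/ weq d (eps 0 ord0), exists i, weq d (eps 1 i) | exists i, weq d (eps (- 2) i)].
Proof.
move=> dw.
pose i0 := @Ordinal 3 0 isT; pose i1 := @Ordinal 3 1 isT; pose i2 := @Ordinal 3 2 isT.
have n01 : i0 != i1 by []. have n12 : i1 != i2 by []. have n02 : i0 != i2 by [].
have n10 : i1 != i0 by []. have n21 : i2 != i1 by []. have n20 : i2 != i0 by [].
have [p pE] := weight_int rep i0 i1 dw; have [q qE] := weight_int rep i1 i2 dw.
have big : (p ^+ 2 + q ^+ 2 + (p + q) ^+ 2 <= 8)%R.
  rewrite -(ler_int R) !rmorphD /= !rmorphXn rmorphD /= -pE -qE.
  have := wmax dw; rewrite (wnormE _ n01 n12 n02); lra.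
have wq (c : 'I_3 -> R) : c i0 - c i1 = p%:~R -> c i1 - c i2 = q%:~R -> weq d c.
  by move=> cp cq; apply: (weqI3 n01 n12 n02); rewrite ?cp ?cq.
have iw c : c i0 - c i1 = p%:~R -> c i1 - c i2 = q%:~R -> is_weight c.
  by move=> cp cq; apply: is_weight_weq dw; apply: wq.
have E i : (eps (- 1) i i0 - eps (- 1) i i1 = p%:~R :> R) -> (eps (- 1) i i1 - eps (- 1) i i2 = q%:~R :> R) -> False.
  by move=> cp cq; apply: (@not_weight_Ndl i); apply: iw.
have E2 i : (eps 2 i i0 - eps 2 i i1 = p%:~R :> R) -> (eps 2 i i1 - eps 2 i i2 = q%:~R :> R) -> False.
  by move=> cp cq; apply: (@not_weight_2dl i); apply: iw.
have E3 i j : i != j -> (root_wt R i j i0 - root_wt R i j i1 = p%:~R :> R) ->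
    (root_wt R i j i1 - root_wt R i j i2 = q%:~R :> R) -> False.
  by move=> ij cp cq; apply: (@not_weight_root i j) => //; apply: iw.
have [pl pu] : -2 <= p /\ p <= 2 by split; nia.
have [ql qu] : -2 <= q /\ q <= 2 by split; nia.
have pq : p \in [:: -2; -1; 0; 1; 2] /\ q \in [:: -2; -1; 0; 1; 2].
  by rewrite !inE; split; lia.
have {pl pu ql qu pE qE} [] := pq; rewrite !inE.
Ltac fin := rewrite /eps /root_wt /= ?mulr1 ?mulr0 ?(subr0, sub0r, opprK, subrr) //; ring.
move=> /or4P[/eqP ?|/eqP ?|/eqP ?|/orP[]/eqP ?];
move=> /or4P[/eqP ?|/eqP ?|/eqP ?|/orP[]/eqP ?]; subst; try (by move: big);
  first [ by constructor 1; apply: wq; fin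
        | by constructor 2; first [by exists i0; apply: wq; fin | by exists i1; apply: wq; fin|by exists i2; apply: wq; fin]
        | by constructor 3; first [by exists i0; apply: wq; fin | by exists i1; apply: wq; fin|by exists i2; apply: wq; fin]
        | by exfalso; first [by apply: (E i0); fin|by apply: (E i1); fin|by apply: (E i2); fin
             |by apply: (E2 i0); fin|by apply: (E2 i1); fin|by apply: (E2 i2); fin
             |by apply: (E3 i0 i1); fin|by apply: (E3 i1 i0); fin|by apply: (E3 i0 i2); fin
             |by apply: (E3 i2 i0); fin|by apply: (E3 i1 i2); fin|by apply: (E3 i2 i1); fin]].
Qed.
End Tight.

(** * The submodules Her(E^* ) and E *)

Section Structure.
Variables (R : rcfType) (n' : nat).
Local Notation n := n'.+1.
Variable rho : cmx R 3 3 -> 'M[R]_n.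
Hypothesis rep : is_rep rho.
Local Notation H := (rH rho).
Local Notation X := (rE rho).
Local Notation Y := (rF rho).
Local Notation G := (rG rho).
Local Notation wt := (wt rho).
Local Notation is_weight := (is_weight rho).
Implicit Types (c d : 'I_3 -> R) (u v : 'cV[R]_n).

Hypothesis Wcol : forall i u v, wt (eps (- 2) i) u -> wt (eps (- 2) i) v -> v != 0 ->
  exists r, u = r *: v.
Hypothesis Wcases : forall d, is_weight d ->
  [\/ weq d (eps 0 ord0), exists i, weq d (eps 1 i) | exists i, weq d (eps (- 2) i)].

Lemma weight_norms d : is_weight d -> [\/ wnorm d = 0, wnorm d = 4 | wnorm d = 16].
Proof.
case/Wcases => [e|[i e]|[i e]]; rewrite (wnorm_weq e) wnorm_dl.
- constructor 1; ring.
- constructor 2; ring.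
- constructor 3; ring.
Qed.

(* op true i j is the action of i E_ij, op false i j that of E_ij. *)
Definition op (s : bool) i j := if s then Y i j else X i j.
Definition cartan (s : bool) i j := if s then G i j else H i j.
(** The sign in i^s i^t = [op_sign s t] i^(s (+) t), with booleans as exponents. *)
Definition op_sign (s t : bool) : R := if s && t then - 1 else 1.

Lemma op_op s t i j : i != j ->
  op s i j *m op t j i = op t j i *m op s i j + op_sign s t *: cartan (s (+) t) i j.
Proof.
by move=> ij; case: s t => [] [] /=; rewrite /op_sign /= ?scale1r;
  [apply: rF_rF_opp|apply: rF_rE_opp|apply: rE_rF_opp|apply: rE_rE_opp].
Qed.

Lemma op3 s t i j k : i != j -> j != k -> i != k ->
  op s i j *m op t j k = op t j k *m op s i j + op_sign s t *: op (s (+) t) i k.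
Proof.
by move=> ij jk ik; case: s t => [] [] /=; rewrite /op_sign /= ?scale1r;
  [apply: rF_rF_chain|apply: rF_rE_chain|apply: rE_rF_chain|apply: rE_rE_chain].
Qed.

Lemma opC s t i j k l : i != j -> k != l -> j != k -> i != l ->
  op s i j *m op t k l = op t k l *m op s i j.
Proof.
move=> ij kl jk il; case: s t => [] [] /=; [exact: rF_rF_comm| |exact: rE_rF_comm|exact: rE_rE_comm].
by rewrite rE_rF_comm // eq_sym.
Qed.

Lemma wt_op s i j c v : i != j -> wt c v -> wt (fun k => c k + root_wt R i j k) (op s i j *m v).
Proof. by case: s; [exact: wt_rF|exact: wt_rE]. Qed.

(** A shifted weight whose norm is not 0, 4 or 16 is not a weight of W. *)
Lemma op_kill s i j c v : i != j -> wt c v ->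
  let N := wnorm (fun k => c k + root_wt R i j k) in
  N != 0 -> N != 4 -> N != 16 -> op s i j *m v = 0.
Proof.
move=> ij cv N N0 N4 N16; apply: (@wt_notweight _ _ rho _ _ _ (wt_op s ij cv)).
by case/weight_norms => /eqP; apply/negP.
Qed.

Ltac wcalc ij jk ik := rewrite (wnormE _ ij jk ik) /eps /root_wt; simp_eq;
  apply/eqP => ?; lra.

Lemma op_kill_top1 s i j v : i != j -> wt (eps (- 2) i) v -> op s j i *m v = 0.
Proof.
move=> ij iv; have [k [jk ik]] := I3_third ij; have ji : j != i by rewrite eq_sym.
by apply: (op_kill _ ji iv); wcalc ij jk ik.
Qed.

Lemma op_kill_top2 s i j k v : i != j -> j != k -> i != k ->
  wt (eps (- 2) i) v -> op s j k *m v = 0.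
Proof. by move=> ij jk ik iv; apply: (op_kill _ jk iv); wcalc ij jk ik. Qed.

Lemma op_kill_low s i j v : i != j -> wt (eps 1 i) v -> op s i j *m v = 0.
Proof.
move=> ij iv; have [k [jk ik]] := I3_third ij.
by apply: (op_kill _ ij iv); wcalc ij jk ik.
Qed.

Lemma op_kill_zero s i j v : i != j -> wt (eps 0 ord0) v -> op s i j *m v = 0.
Proof.
move=> ij iv; have [k [jk ik]] := I3_third ij.
by apply: (op_kill _ ij iv); rewrite (wnormE _ ij jk ik) /eps /root_wt; simp_eq;
  rewrite !mul0r; apply/eqP => ?; lra.
Qed.

Lemma rG_add i j k : G i j + G j k = G i k.
Proof.
rewrite /rG -rhoD //; try exact: sl3_matiH; congr rho.
by rewrite /cadd /matiH /= addr0 addrA subrK.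
Qed.

Lemma rG_sym i j : G j i = - G i j.
Proof.
apply/eqP; rewrite -addr_eq0 rG_add -(inj_eq (addrI (G j j))) rG_add addr0; exact/eqP.
Qed.

Section Top.
Variables (a : 'I_3) (v : 'cV[R]_n).
Hypotheses (v0 : v != 0) (av : wt (eps (- 2) a) v).

Section Pair.
Variables (j k : 'I_3).
Hypotheses (aj : a != j) (jk : j != k) (ak : a != k).
Let ja : j != a. Proof. by rewrite eq_sym. Qed.
Let ka : k != a. Proof. by rewrite eq_sym. Qed.
Let kj : k != j. Proof. by rewrite eq_sym. Qed.

(** The shifted weight is - e_a - e_j, which is e_k up to a constant. *)
Lemma wt_mid s : wt (eps 1 k) (op s a j *m v).
Proof.
by apply: wt_weq (wt_op s aj av); apply: (weqI3 aj jk ak); rewrite /eps /root_wt; simp_eq; ring.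
Qed.

Lemma wt_top s t : wt (eps (- 2) j) (op s a j *m (op t a j *m v)).
Proof.
by apply: wt_weq (wt_op s aj (wt_mid t)); apply: (weqI3 aj jk ak); rewrite /eps /root_wt; simp_eq; ring.
Qed.

Lemma top_raise s t : op s j a *m (op t a j *m v) = op_sign s t *: (cartan (s (+) t) j a *m v).
Proof.
by rewrite mulmxA op_op // mulmxDl -mulmxA (op_kill_top1 s aj av) mulmx0 add0r -scalemxAl.
Qed.

Lemma rH_top : H j a *m v = 2 *: v.
Proof. by rewrite av /eps; simp_eq; congr (_ *: _); ring. Qed.

Lemma rH_mid s : H j a *m (op s a j *m v) = 0.
Proof.
by rewrite (wt_mid s) /eps; simp_eq; rewrite (_ : _ - _ = 0) ?scale0r //; ring.
Qed.

Lemma top_indep : indep (X a j *m v) (Y a j *m v).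
Proof.
apply: (rE_rF_indep rep aj _ _ rH_top) => //; last by rewrite pnatr_eq0.
  exact: (op_kill_top1 false aj av).
exact: (op_kill_top1 true aj av).
Qed.

Lemma top_E_neq0 : X a j *m v != 0.
Proof.
apply/eqP => X0; have := top_indep => /(_ 1 0).
by rewrite X0 scaler0 scale0r addr0 => /(_ erefl) [/eqP]; rewrite oner_eq0.
Qed.

Lemma lowerE_EE : X j a *m (X a j *m (X a j *m v)) = 2 *: (X a j *m v).
Proof.
rewrite mulmxA rE_rE_opp // mulmxDl (rH_mid false) addr0 -mulmxA.
have := top_raise false false; rewrite /= /op_sign /= scale1r rH_top => ->.
by rewrite -scalemxAr.
Qed.

Lemma top_EE_neq0 : X a j *m (X a j *m v) != 0.
Proof.
apply/eqP => X0; have := lowerE_EE; rewrite X0 mulmx0 => /esym/eqP.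
by rewrite scaler_eq0 pnatr_eq0 (negPf top_E_neq0).
Qed.

(** The weight spaces of -2 e_a and -2 e_j are lines, so G_ja v = r v, E_aj (i E_aj) v = y E_aj^2 v
    and (i E_aj)^2 v = y' E_aj^2 v for scalars r, y, y'. Applying E_ja to the last two gives 2y = r
    and (2 - 2y') E_aj v + 2r (i E_aj) v = 0; by independence r = y = 0 and y' = 1. *)
Lemma top_relations : [/\ G j a *m v = 0, X a j *m (Y a j *m v) = 0 &
  Y a j *m (Y a j *m v) = X a j *m (X a j *m v)].
Proof.
have [r rE] : exists r, G j a *m v = r *: v by apply: (Wcol (wt_rG rep ja av) av v0).
have [y yE] := Wcol (wt_top false true) (wt_top false false) top_EE_neq0.
have [y' yE'] := Wcol (wt_top true true) (wt_top false false) top_EE_neq0.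
rewrite /= in yE yE'.
have rXX := top_raise false false; have rXY := top_raise false true.
have rYX := top_raise true false.
rewrite /= /op_sign /= !scale1r in rXX rXY rYX.
have eq1 : (2 * y) *: (X a j *m v) = r *: (X a j *m v).
  move: (congr1 (mulmx (X j a)) yE); rewrite -scalemxAr lowerE_EE scalerA mulrC => <-.
  by rewrite mulmxA rE_rE_opp // mulmxDl (rH_mid true) addr0 -mulmxA rXY rE -scalemxAr.
have yc : y = r / 2.
  have /eqP : (2 * y - r) *: (X a j *m v) = 0 by rewrite scalerBl eq1 subrr.
  by rewrite scaler_eq0 (negPf top_E_neq0) orbF => /eqP e; lra.
have eq2 : (2 - 2 * y') *: (X a j *m v) + (2 * r) *: (Y a j *m v) = 0.
  move: (congr1 (mulmx (X j a)) yE'); rewrite -scalemxAr lowerE_EE scalerA => e.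
  have : X j a *m (Y a j *m (Y a j *m v)) = 2 *: (X a j *m v) + (2 * r) *: (Y a j *m v).
    rewrite mulmxA rE_rF_opp // mulmxDl -mulmxA rXY rE -scalemxAr.
    rewrite rG_sym mulNmx [G a j *m _]mulmxA rG_rF // mulmxDl -mulmxA -[G a j]opprK -rG_sym mulNmx rE.
    by rewrite mulmxN -scalemxAr -scalemxAl; mx_ring.
  by rewrite e => e'; rewrite scalerBl addrAC -e' [y' * 2]mulrC subrr.
have [e1 e2] := top_indep eq2.
have r0 : r = 0 by lra.
rewrite rE yE yE' yc r0 mul0r !scale0r; split=> //.
by rewrite (_ : y' = 1) ?scale1r //; lra.
Qed.
End Pair.

Section Table.
Variables (j k : 'I_3).
Hypotheses (aj : a != j) (jk : j != k) (ak : a != k).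
Let ja : j != a. Proof. by rewrite eq_sym. Qed.
Let ka : k != a. Proof. by rewrite eq_sym. Qed.
Let kj : k != j. Proof. by rewrite eq_sym. Qed.
(** In Her, with v the matrix unit u_aa, these are P = - (u_aj + u_ja), Q = - i (u_aj - u_ja), Z = 2
    u_jj, S = u_jk + u_kj and T = i (u_jk - u_kj); P', Q', Z' are P, Q, Z with k for j. The lemmas
    below recover the action of E_aj, i E_aj, E_ja, i E_ja on them. *)
Let P := X a j *m v.
Let Q := Y a j *m v.
Let P' := X a k *m v.
Let Q' := Y a k *m v.
Let Z := X a j *m P.
Let Z' := X a k *m P'.
Let S := X a j *m P'.
Let T := X a j *m Q'.
Let Grel := top_relations aj jk ak.

Lemma rG_top : G j a *m v = 0. Proof. by case: Grel. Qed.
Lemma top_EF : X a j *m Q = 0. Proof. by case: Grel. Qed.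
Lemma top_FE : Y a j *m P = 0.
Proof. by rewrite mulmxA -rE_rF_comm // -mulmxA top_EF. Qed.
Lemma top_FF : Y a j *m Q = Z. Proof. by case: Grel. Qed.

(** Only the bracket of the (a, j) and (j, k) operators survives on x. This replaces the index j by
    k and so carries relations for j over to the pair j, k. *)
Lemma shift_jk s t (x : 'cV[R]_n) : op s j k *m x = 0 -> 
  op s j k *m (op t a j *m x) = - (op_sign s t *: (op (s (+) t) a k *m x)).
Proof.
move=> sx; apply/eqP; rewrite -addr_eq0; apply/eqP.
have := op3 t s aj jk ak => /(congr1 (mulmx^~ x)).
rewrite mulmxDl -!mulmxA sx mulmx0 -scalemxAl => /esym.
by rewrite addbC /op_sign andbC.
Qed.

Lemma top_kill_side s : op s j k *m v = 0.
Proof. exact: (op_kill_top2 s aj jk ak av). Qed.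

Lemma top_EE_sym : X a k *m P = S.
Proof. by rewrite /S /P /P' !mulmxA rE_rE_comm. Qed.

(** Polarization: E_jk is applied to the relation E_aj Q = 0. *)
Lemma top_cross_EF : X a k *m Q = - T.
Proof.
have := top_EF => /(congr1 (mulmx (X j k))); rewrite mulmx0 mulmxA.
have -> : X j k *m X a j = X a j *m X j k - X a k.
  by rewrite rE_rE_chain // addrK.
have := @shift_jk false true v (top_kill_side false); rewrite /= /op_sign /= scale1r => e.
rewrite mulmxBl -mulmxA e mulmxN -/Q -/Q' -/T => /eqP.
by rewrite -opprD oppr_eq0 addrC addr_eq0 => /eqP.
Qed.

Lemma top_cross_FE : Y a j *m P' = - T.
Proof. by rewrite -top_cross_EF !mulmxA rE_rF_comm. Qed.

(** Polarization of (i E_aj) Q = Z by E_jk: each side becomes -2 times the corresponding side of the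
    claim. *)
Lemma top_cross_FF : Y a j *m Q' = S.
Proof.
have := top_FF => /(congr1 (mulmx (X j k))); rewrite /Z !mulmxA.
have -> : X j k *m X a j = X a j *m X j k - X a k.
  by rewrite rE_rE_chain // addrK.
have -> : X j k *m Y a j = Y a j *m X j k - Y a k.
  by rewrite rF_rE_chain // addrK.
have e1 := @shift_jk false true v (top_kill_side false).
have e2 := @shift_jk false false v (top_kill_side false).
rewrite /= /op_sign /= !scale1r in e1 e2.
rewrite !mulmxBl -!mulmxA e1 e2 !mulmxN -/Q -/Q' -/P -/P' -/S.
have -> : Y a k *m Q = Y a j *m Q' by rewrite !mulmxA rF_rF_comm.
rewrite top_EE_sym -!opprD => /oppr_inj e; apply/matrixP => x y.
have /matrixP/(_ x y) := e; rewrite [LHS]mxE [RHS]mxE => ?; lra.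
Qed.

Lemma raise_EE s : op s a j *m Z = 0.
Proof. exact: (op_kill_top1 s ja (wt_top aj jk ak false false)). Qed.
Lemma raise_EE_side s : op s a j *m Z' = 0.
Proof. exact: (op_kill_top2 s ka aj kj (wt_top ak kj aj false false)). Qed.
Lemma wt_S s t : wt (eps 1 a) (op s a j *m (op t a k *m v)).
Proof.
apply: wt_weq (wt_op s aj (wt_mid ak kj aj t)).
by apply: (weqI3 aj jk ak); rewrite /eps /root_wt; simp_eq; ring.
Qed.
Lemma raise_cross_EE s : op s a j *m S = 0.
Proof. exact: (op_kill_low s aj (wt_S false false)). Qed.
Lemma raise_cross_EF s : op s a j *m T = 0.
Proof. exact: (op_kill_low s aj (wt_S false true)). Qed.

Lemma lower_v s : op s j a *m v = 0.
Proof. exact: (op_kill_top1 s aj av). Qed.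
Lemma lower_op s t : op s j a *m (op t a j *m v) = op_sign s t *: (cartan (s (+) t) j a *m v).
Proof. by rewrite mulmxA op_op // mulmxDl -mulmxA lower_v mulmx0 add0r -scalemxAl. Qed.
Lemma lowerE_E : X j a *m P = 2 *: v.
Proof. by rewrite (lower_op false false) scale1r rH_top. Qed.
Lemma lowerF_E : Y j a *m P = 0.
Proof. by rewrite (lower_op true false) scale1r rG_top. Qed.
Lemma lowerE_F : X j a *m Q = 0.
Proof. by rewrite (lower_op false true) scale1r rG_top. Qed.
Lemma lowerF_F : Y j a *m Q = (- 2) *: v.
Proof. by rewrite (lower_op true true) /op_sign /= rH_top // scalerA mulN1r. Qed.
Lemma lower_side s t : op s j a *m (op t a k *m v) = 0.
Proof. by rewrite mulmxA op3 // mulmxDl -mulmxA lower_v mulmx0 add0r -scalemxAl top_kill_side scaler0. Qed.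

Lemma lowerF_EE : Y j a *m Z = (- 2) *: Q.
Proof.
rewrite -top_FF mulmxA rF_rF_opp // mulmxDl -mulmxA lowerF_F -scalemxAl (rH_mid aj jk ak true) scaler0 addr0.
by rewrite -scalemxAr.
Qed.
Lemma lower_EE_side s : op s j a *m Z' = 0.
Proof.
rewrite mulmxA [X a k](_ : _ = op false a k) // op3 // mulmxDl -mulmxA (lower_side s false) mulmx0 add0r.
by rewrite -scalemxAl mulmxA [X a k](_ : _ = op false a k) // opC // -mulmxA top_kill_side mulmx0 scaler0.
Qed.
Lemma rH_side s : H j a *m (op s a k *m v) = op s a k *m v.
Proof.
by rewrite (wt_mid ak kj aj s) /eps; simp_eq; rewrite (_ : _ - _ = 1) ?scale1r //; ring.
Qed.
Lemma lowerE_cross_EE : X j a *m S = P'.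
Proof. by rewrite mulmxA rE_rE_opp // mulmxDl -mulmxA (lower_side false false) mulmx0 add0r (rH_side false). Qed.
Lemma lowerE_cross_EF : X j a *m T = Q'.
Proof. by rewrite mulmxA rE_rE_opp // mulmxDl -mulmxA (lower_side false true) mulmx0 add0r (rH_side true). Qed.
Lemma lowerF_cross_EE : Y j a *m S = - Q'.
Proof.
rewrite -top_cross_FF mulmxA rF_rF_opp // mulmxDl -mulmxA (lower_side true true) mulmx0 add0r.
by rewrite -scalemxAl (rH_side true) scaleN1r.
Qed.
Lemma lowerF_cross_EF : Y j a *m T = P'.
Proof.
rewrite -[T]opprK -top_cross_FE mulmxN mulmxA rF_rF_opp // mulmxDl -mulmxA (lower_side true false) mulmx0 add0r.
by rewrite -scalemxAl (rH_side false) scaleN1r opprK.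
Qed.
End Table.
End Top.
End Structure.

(** * Vectors that behave like the basis vectors of E *)

Section Vectorial.
Variables (R : rcfType) (n' : nat).
Local Notation n := n'.+1.
Variable rho : cmx R 3 3 -> 'M[R]_n.
Hypothesis rep : is_rep rho.
Local Notation H := (rH rho).
Local Notation X := (rE rho).
Local Notation Y := (rF rho).
Local Notation G := (rG rho).
Local Notation wt := (wt rho).
Local Notation is_weight := (is_weight rho).
Local Notation op := (op rho).
Local Notation cartan := (cartan rho).
Implicit Types (c d : 'I_3 -> R) (u v : 'cV[R]_n).
Hypothesis Wcases : forall d, is_weight d ->
  [\/ weq d (eps 0 ord0), exists i, weq d (eps 1 i) | exists i, weq d (eps (- 2) i)].

(* u behaves like the basis vector e_l of E. *)
Definition Evec (l : 'I_3) u :=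
  wt (eps 1 l) u /\ forall s i j, i != j -> j != l -> op s i j *m u = 0.

Lemma Evec_lin l a u v : Evec l u -> Evec l v -> Evec l (a *: u + v).
Proof.
move=> [wu ku] [wv kv]; split; first by apply: wtD => //; apply: wtZ.
by move=> s i j ij jl; rewrite mulmxDr -scalemxAr ku // kv // scaler0 addr0.
Qed.

(** The delicate point is that the (p, l) operators kill op_ml u, for p the third index. Writing
    op_pl as a bracket of op_pm and op_ml, where op_ml kills op_ml u by weights, gives op_pl op_ml u
    = - op_ml op_pl u up to a redistribution of the factors i ([cross]). *)
Lemma Evec_op s l m u : m != l -> Evec l u -> Evec m (op s m l *m u).
Proof.
move=> ml [wu ku]; have [p [lp mp]] := I3_third ml.
have lm : l != m by rewrite eq_sym.
have pm : p != m by rewrite eq_sym.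
have pl : p != l by rewrite eq_sym.
have wm t : wt (eps 1 m) (op t m l *m u).
  apply: wt_weq (wt_op rep t ml wu); apply: (weqI3 ml lp mp);
  by rewrite /eps /root_wt; simp_eq; ring.
have cross t q r : op t p l *m (op r m l *m u) =
    - (op_sign R q (q (+) t) * op_sign R q r) *: (op (q (+) t) m l *m (op (q (+) r) p l *m u)).
  have := op3 rep q (q (+) t) pm ml pl => /(congr1 (mulmx^~ (op r m l *m u))).
  rewrite mulmxDl -!mulmxA (op_kill_low rep Wcases _ ml (wm r)) mulmx0.
  rewrite [op q p m *m _]mulmxA op3 // mulmxDl -mulmxA ku // mulmx0 add0r addbA addbb /=.
  move/esym/eqP; rewrite addrC addr_eq0 -!scalemxAl -scalemxAr.
  move=> /eqP/(congr1 (fun x => op_sign R q (q (+) t) *: x)); rewrite scalerA scalerN scalerA.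
  have -> : op_sign R q (q (+) t) * op_sign R q (q (+) t) = 1.
    by rewrite /op_sign; case: ifP => _; rewrite ?mulrNN mulr1.
  by rewrite scale1r scaleNr.
split=> // t i j ij jm.
have := I3_cover ml lp mp j; rewrite (negPf jm) /= => /orP[]/eqP ?; subst j.
  have := I3_cover ml lp mp i; rewrite (negPf ij) /= => /orP[]/eqP ?; subst i.
    exact: (op_kill_low rep Wcases t ml (wm s)).
  (* With this q the factors i return to their places and the signs cancel. As op_ml and op_pl
     commute, the vector equals its own negative. *)
  pose q := s (+) t; have := cross t q s.
  have -> : q (+) t = s by rewrite /q -addbA addbb addbF.
  have -> : q (+) s = t by rewrite /q addbC addbA addbb.
  have -> : op_sign R q s * op_sign R q s = 1.
    by rewrite /op_sign; case: ifP => _; rewrite ?mulrNN mulr1.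
  have -> : op s m l *m (op t p l *m u) = op t p l *m (op s m l *m u).
    by rewrite !mulmxA opC.
  move=> e; apply/matrixP => x y; have /matrixP/(_ x y) := e.
  by rewrite [RHS]mxE => ?; rewrite [RHS]mxE; lra.
have := I3_cover ml lp mp i; rewrite (negPf ij) orbF /= => /orP[]/eqP ?; subst i.
  by rewrite mulmxA opC // -mulmxA ku ?mulmx0.
have := op3 rep s t ml lp mp => /(congr1 (mulmx^~ u)).
by rewrite mulmxDl -!mulmxA -scalemxAl (ku _ _ _ lp pl) (ku _ _ _ mp pl) mulmx0 scaler0 addr0 => <-.
Qed.

Section Fixed.
Variables (l m : 'I_3) (u : 'cV[R]_n).
Hypotheses (ml : m != l) (uE : Evec l u).
Let lm : l != m. Proof. by rewrite eq_sym. Qed.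

Lemma Evec_kill s i j : i != j -> j != l -> op s i j *m u = 0.
Proof. by case: uE => _; apply. Qed.

Lemma Evec_rH : H l m *m u = u.
Proof. by case: uE => + _ => ->; rewrite /eps; simp_eq; rewrite (_ : _ - _ = 1) ?scale1r //; ring. Qed.

Lemma Evec_back s t : op s l m *m (op t m l *m u) = op_sign R s t *: (cartan (s (+) t) l m *m u).
Proof.
by rewrite mulmxA op_op // mulmxDl -mulmxA Evec_kill // mulmx0 add0r -scalemxAl.
Qed.

Lemma Evec_rG0 i j : i != j -> i != l -> j != l -> G i j *m u = 0.
Proof.
move=> ij il jl; have ji : j != i by rewrite eq_sym.
have := rE_rF_opp rep ij => /(congr1 (mulmx^~ u)); rewrite mulmxDl -!mulmxA.
by rewrite (Evec_kill false ij) // (Evec_kill true ji) // !mulmx0 add0r => <-.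
Qed.

Lemma Evec_rG : Evec l (G l m *m u).
Proof.
have := Evec_back false true; rewrite /op_sign /= scale1r => <-.
exact: (Evec_op false lm (Evec_op true ml uE)).
Qed.
End Fixed.

(** Multiplication by i on these vectors is G_lm, for either choice of m. *)
Lemma Evec_rG_indep l m p u : m != l -> p != l -> m != p -> Evec l u -> G l m *m u = G l p *m u.
Proof. by move=> ml pl mp uE; rewrite -(rG_add rep l m p) mulmxDl (Evec_rG0 uE mp) ?addr0. Qed.

Lemma Evec_rE_rG l m u : m != l -> Evec l u -> X m l *m (G l m *m u) = Y m l *m u.
Proof.
move=> ml uE; have lm : l != m by rewrite eq_sym.
have := Evec_back ml uE false true; rewrite /op_sign /= scale1r => <-.
have yE := Evec_op true ml uE.
have [p [lp mp]] := I3_third ml.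
rewrite mulmxA rE_rE_opp // mulmxDl -mulmxA [X m l *m _](op_kill_low rep Wcases false ml yE.1).
by rewrite mulmx0 add0r (Evec_rH lm yE).
Qed.

Lemma Evec_rF_rG l m u : m != l -> Evec l u -> Y m l *m (G l m *m u) = - (X m l *m u).
Proof.
move=> ml uE; have lm : l != m by rewrite eq_sym.
have := Evec_back ml uE true false; rewrite /op_sign /= scale1r => <-.
have yE := Evec_op false ml uE.
rewrite mulmxA rF_rF_opp // mulmxDl -mulmxA [Y m l *m _](op_kill_low rep Wcases true ml yE.1).
by rewrite mulmx0 add0r -scalemxAl (Evec_rH lm yE) scaleN1r.
Qed.

(** The inner G_lm u is again a vector of this kind, so the outer G_lm may be replaced by E_lm (i
    E_ml), and i E_ml sends G_lm u to - E_ml u. *)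
Lemma Evec_rG_rG l m u : m != l -> Evec l u -> G l m *m (G l m *m u) = - u.
Proof.
move=> ml uE; have GE := Evec_rG ml uE.
have := Evec_back ml GE false true; rewrite /op_sign /= scale1r => <-.
rewrite Evec_rF_rG // mulmxN; congr (- _).
by have := Evec_back ml uE false false; rewrite /op_sign /= scale1r Evec_rH.
Qed.

(** The vector op_pm u has weight -2 e_m, where the lowering operator op_mp is injective. Since H_mp
    u = 0 and op_mp kills u, it kills op_pm u, so op_pm u = 0. The remaining operators vanish by
    weights. *)
Lemma Evec_crit l m p u : m != l -> p != l -> m != p -> wt (eps 1 l) u ->
  (forall s, op s m p *m u = 0) -> Evec l u.
Proof.
move=> ml pl mp wu k1; split=> // s i j ij jl.
have lm : l != m by rewrite eq_sym.
have lp : l != p by rewrite eq_sym.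
have pm : p != m by rewrite eq_sym.
have Hu : H m p *m u = 0.
  by rewrite wu /eps; simp_eq; rewrite (_ : _ - _ = 0) ?scale0r //; ring.
have wpm t : wt (eps (- 2) m) (op t p m *m u).
  apply: wt_weq (wt_op rep t pm wu); apply: (weqI3 ml lp mp);
  by rewrite /eps /root_wt; simp_eq; ring.
have d2 : (1 : R) <= eps (- 2) m p - eps (- 2) m m by rewrite /eps; simp_eq; lra.
have kpm t : op t p m *m u = 0.
  case: t.
    apply: (lowerF_inj rep pm d2 (wpm true)).
    by rewrite mulmxA rF_rF_opp // mulmxDl -mulmxA (k1 true) -scalemxAl Hu mulmx0 add0r scaler0.
  apply: (lowerE_inj rep pm d2 (wpm false)).
  by rewrite mulmxA rE_rE_opp // mulmxDl -mulmxA (k1 false) Hu mulmx0 add0r.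
have := I3_cover ml lp mp j; rewrite (negPf jl) /= => /orP[]/eqP ?; subst j.
  have := I3_cover ml lp mp i; rewrite (negPf ij) /= => /orP[]/eqP ?; subst i.
    exact: (op_kill_low rep Wcases).
  exact: kpm.
have := I3_cover ml lp mp i; rewrite (negPf ij) orbF /= => /orP[]/eqP ?; subst i.
  exact: k1.
exact: (op_kill_low rep Wcases).
Qed.

End Vectorial.

(** * Bases of subspaces, real and complex *)

Section Bases.
Variables (R : rcfType) (n : nat).
Variable P : 'cV[R]_n -> Prop.
Hypothesis P0 : P 0.
Hypothesis Plin : forall a u v, P u -> P v -> P (a *: u + v).

Lemma injective_leq m (B : 'M[R]_(n, m)) :
  (forall z : 'cV_m, B *m z = 0 -> z = 0) -> (m <= n)%N.
Proof.
move=> Binj; suff /eqP <- : row_free B^T by exact: rank_leq_col.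
apply: inj_row_free => z /(congr1 trmx); rewrite trmx_mul trmxK trmx0 => /Binj.
by move/(congr1 trmx); rewrite trmxK trmx0.
Qed.

Lemma mul_row_mx1 m (B : 'M[R]_(n, m)) (u : 'cV[R]_n) (z : 'cV[R]_(m + 1)) :
  row_mx B u *m z = B *m usubmx z + dsubmx z 0 0 *: u.
Proof.
rewrite -{1}[z]vsubmxK mul_row_col; congr (_ + _).
by rewrite [in LHS](mx11_scalar (dsubmx z)) mul_mx_scalar.
Qed.

Lemma col_split0 m (z : 'cV[R]_(m + 1)) : usubmx z = 0 -> dsubmx z 0 0 = 0 -> z = 0.
Proof.
move=> u0 d0; rewrite -[z]vsubmxK u0 [dsubmx z]mx11_scalar d0.
by rewrite raddf0 col_mx0.
Qed.

Lemma extend_injective m (B : 'M[R]_(n, m)) u :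
  (forall z : 'cV_m, B *m z = 0 -> z = 0) -> ~ (exists z : 'cV_m, u = B *m z) ->
  forall z : 'cV_(m + 1), row_mx B u *m z = 0 -> z = 0.
Proof.
move=> Binj uz z; rewrite mul_row_mx1 => Bz.
have [s0|s0] := eqVneq (dsubmx z 0 0) 0.
  by apply: col_split0 => //; apply: Binj; rewrite -[RHS]Bz s0 scale0r addr0.
case: uz; exists (- (dsubmx z 0 0)^-1 *: usubmx z).
rewrite -scalemxAr scaleNr -scalerN; apply: (scalerI s0).
by rewrite scalerA mulfV // scale1r; apply/eqP; rewrite -addr_eq0 addrC; apply/eqP.
Qed.

(** A family with m independent columns is extended as long as some vector of P lies outside its
    span; the induction is on n - m. *)
Lemma subspace_basis : exists m (B : 'M[R]_(n, m)),
  [/\ forall z : 'cV_m, P (B *m z), forall z : 'cV_m, B *m z = 0 -> z = 0 &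
      forall u, P u -> exists z : 'cV_m, u = B *m z].
Proof.
suff ext d : forall m (B : 'M[R]_(n, m)), (n - m <= d)%N ->
    (forall z : 'cV_m, P (B *m z)) -> (forall z : 'cV_m, B *m z = 0 -> z = 0) ->
    exists m (B : 'M[R]_(n, m)),
    [/\ forall z : 'cV_m, P (B *m z), forall z : 'cV_m, B *m z = 0 -> z = 0 &
      forall u, P u -> exists z : 'cV_m, u = B *m z].
  apply: (ext n 0%N 0); first by rewrite subn0.
    by move=> z; rewrite mul0mx.
  by move=> z _; apply/matrixP => [[]].
elim: d => [|d IH] m B nm PB Binj;
  have [span|nspan] :=
    classic (forall u, P u -> exists z : 'cV_m, u = B *m z);
  try (by exists m, B);
  have [u nu] := not_all_ex_not _ _ nspan; have [Pu uz] := imply_to_and _ _ nu;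
  have Binj' := extend_injective Binj uz.
  by have := injective_leq Binj'; lia.
apply: (IH (m + 1)%N (row_mx B u)) => //; first by lia.
by move=> z; rewrite mul_row_mx1 addrC; apply: Plin.
Qed.

Variable J : 'M[R]_n.
Hypothesis JJ : forall u, P u -> J *m (J *m u) = - u.

(** In a relation with coefficient s + i s' at u, with J as i, multiplication by s - i s' isolates
    (s^2 + s'^2) u in the complex span of U. *)
Lemma extend_complex m (U : 'M[R]_(n, m)) u :
  (forall z : 'cV_m, P (U *m z)) -> P u ->
  (forall z z' : 'cV_m, U *m z + J *m (U *m z') = 0 -> z = 0 /\ z' = 0) ->
  ~ (exists z z' : 'cV_m, u = U *m z + J *m (U *m z')) ->
  forall z z' : 'cV_(m + 1),
    row_mx U u *m z + J *m (row_mx U u *m z') = 0 -> z = 0 /\ z' = 0.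
Proof.
move=> PU Pu Uinj uz z z'; rewrite !mul_row_mx1.
set s := dsubmx z 0 0; set s' := dsubmx z' 0 0; set x := usubmx z; set x' := usubmx z'.
move=> e1.
have e2 := congr1 (mulmx J) e1; rewrite mulmx0 in e2.
rewrite !mulmxDr -!scalemxAr !JJ // in e1 e2.
have key : (s ^+ 2 + s' ^+ 2) *: u =
    U *m (- s *: x - s' *: x') + J *m (U *m (s' *: x - s *: x')).
  rewrite -[RHS]addr0 -(scaler0 _ s) -{1}e1 -[RHS]subr0 -(scaler0 _ s') -{1}e2.
  rewrite !(mulmxDr, mulmxN, =^~ scalemxAr).
  move: (U *m x) (U *m x') (J *m (U *m x)) (J *m (U *m x')) (J *m u) => A1 A2 A3 A4 A5.
  by mx_ring.
have [ss0|ss0] := eqVneq (s ^+ 2 + s' ^+ 2) 0; last first.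
  case: uz; exists ((s ^+ 2 + s' ^+ 2)^-1 *: (- s *: x - s' *: x')).
  exists ((s ^+ 2 + s' ^+ 2)^-1 *: (s' *: x - s *: x')).
  by rewrite -!scalemxAr -scalerDr -key scalerA mulVf // scale1r.
move/eqP: ss0; rewrite paddr_eq0 ?sqr_ge0 // !sqrf_eq0 => /andP[/eqP s0 /eqP s'0].
move: e1; rewrite s0 s'0 !scale0r !addr0 => /Uinj[x0 x'0].
by split; apply: col_split0.
Qed.

Lemma complex_basis : exists m (U : 'M[R]_(n, m)),
  [/\ forall z : 'cV_m, P (U *m z),
      forall z z' : 'cV_m, U *m z + J *m (U *m z') = 0 -> z = 0 /\ z' = 0 &
      forall u, P u -> exists z z' : 'cV_m, u = U *m z + J *m (U *m z')].
Proof.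
suff ext d : forall m (U : 'M[R]_(n, m)), (n - m <= d)%N ->
    (forall z : 'cV_m, P (U *m z)) ->
    (forall z z' : 'cV_m, U *m z + J *m (U *m z') = 0 -> z = 0 /\ z' = 0) ->
    exists m (U : 'M[R]_(n, m)),
    [/\ forall z : 'cV_m, P (U *m z),
      forall z z' : 'cV_m, U *m z + J *m (U *m z') = 0 -> z = 0 /\ z' = 0 &
      forall u, P u -> exists z z' : 'cV_m, u = U *m z + J *m (U *m z')].
  apply: (ext n 0%N 0); first by rewrite subn0.
    by move=> z; rewrite mul0mx.
  by move=> z z' _; split; apply/matrixP => [[]].
elim: d => [|d IH] m U nm PU Uinj;
  have [span|nspan] :=
    classic (forall u, P u -> exists z z' : 'cV_m, u = U *m z + J *m (U *m z'));
  try (by exists m, U);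
  have [u nu] := not_all_ex_not _ _ nspan; have [Pu uz] := imply_to_and _ _ nu;
  have Uinj' := extend_complex PU Pu Uinj uz.
(* The case z' = 0 is real independence of the columns, which bounds their number by n. *)
all: have mn : (m + 1 <= n)%N by apply: (@injective_leq _ (row_mx U u)) => z Uz;
  have [] := Uinj' z 0; rewrite // mulmx0 mulmx0 addr0.
  by lia.
apply: (IH (m + 1)%N (row_mx U u)) => //; first by lia.
by move=> z; rewrite mul_row_mx1 addrC; apply: Plin.
Qed.
End Bases.

(** * The isomorphism with the model *)

Section Model.
Variable R : rcfType.

Lemma mul_delta_l m p (i : 'I_m) (j : 'I_m) (M : 'M[R]_(m, p)) x y :
  (delta_mx i j *m M) x y = (x == i)%:R * M j y.
Proof.
rewrite mxE (bigD1 j) //= big1 ?addr0 => [|k /negPf kj]; rewrite !mxE ?eqxx ?andbT //.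
by rewrite kj andbF mul0r.
Qed.

Lemma mul_delta_r m p (i j : 'I_p) (M : 'M[R]_(m, p)) x y :
  (M *m delta_mx i j) x y = M x i * (y == j)%:R.
Proof.
rewrite mxE (bigD1 i) //= big1 ?addr0 => [|k /negPf ki]; rewrite !mxE ?eqxx //.
by rewrite ki mulr0.
Qed.

Variables k l m : nat.
Local Notation model := (model R k l m).
Implicit Types (t : model) (A B : cmx R 3 3).

Let trD p q (M N : 'M[R]_(p, q)) : (M + N)^T = M^T + N^T. Proof. exact: raddfD. Qed.
Let trN p q (M : 'M[R]_(p, q)) : (- M)^T = - M^T. Proof. exact: raddfN. Qed.
Let trZ p q c (M : 'M[R]_(p, q)) : (c *: M)^T = c *: M^T. Proof. exact: linearZ. Qed.

Ltac cmx_ring := congr pair; rewrite ?(trD, trN, trZ, trmx_mul);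
  rewrite ?(mulmxDl, mulmxDr, mulmxN, mulNmx, =^~ scalemxAl, =^~ scalemxAr);
  rewrite ?mulmxA; gen_mul; mx_ring.

Lemma model_eq t t' : t.1.1.1 = t'.1.1.1 -> t.1.1.2 = t'.1.1.2 -> t.1.2 = t'.1.2 ->
  t.2 = t'.2 -> t = t'.
Proof. by case: t t' => [[[? ?] ?] ?] [[[? ?] ?] ?] /= -> -> -> ->. Qed.

Lemma model_act_add A B t : model_act (cadd A B) t = model_add (model_act A t) (model_act B t).
Proof.
apply: model_eq; rewrite /= /cneg /cadd /cmul /cadj /cconj /=; try cmx_ring.
by rewrite addr0.
Qed.

Lemma model_act_scale a A t : model_act (cscale a A) t = model_scale a (model_act A t).
Proof.
apply: model_eq; rewrite /= /cneg /cadd /cmul /cadj /cconj /cscale /=; try cmx_ring.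
by rewrite scaler0.
Qed.

Lemma model_act_lie A B t : model_act (lie A B) t =
  model_add (model_act A (model_act B t)) (model_scale (- 1) (model_act B (model_act A t))).
Proof.
apply: model_eq; rewrite /= /lie /cneg /cadd /cmul /cadj /cconj /cscale /=; try cmx_ring.
by rewrite scaler0 addr0.
Qed.

Lemma hermitian_act A t : Defs.hermitian t.1.1.1 -> Defs.hermitian (model_act A t).1.1.1.
Proof.
case=> h1 h2; split; rewrite /= /cneg /cadd /cmul /cadj /=;
  by rewrite !(trD, trN, trmx_mul, trmxK) h1 h2 ?(mulNmx, mulmxN); gen_mul; mx_ring.
Qed.

Section Generators.
Variables (i j : 'I_3) (t : model).
Local Notation h := t.1.1.1.

Lemma act_matE_herm1 x y : (model_act (matE R i j) t).1.1.1.1 x y =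
  - ((x == j)%:R * h.1 i y + h.1 x i * (y == j)%:R).
Proof.
rewrite /= /cmul /= trmx0 oppr0 !mul0mx !mulmx0 !subr0 trmx_delta [LHS]mxE [X in - X]mxE.
by rewrite mul_delta_l mul_delta_r.
Qed.
Lemma act_matE_herm2 x y : (model_act (matE R i j) t).1.1.1.2 x y =
  - ((x == j)%:R * h.2 i y + h.2 x i * (y == j)%:R).
Proof.
rewrite /= /cmul /= trmx0 oppr0 !mul0mx !mulmx0 !addr0 add0r trmx_delta [LHS]mxE [X in - X]mxE.
by rewrite mul_delta_l mul_delta_r.
Qed.
Lemma act_matiE_herm1 x y : (model_act (matiE R i j) t).1.1.1.1 x y =
  - ((x == j)%:R * h.2 i y - h.2 x i * (y == j)%:R).
Proof.
rewrite /= /cmul /= trmx0 !mul0mx !mulmx0 !sub0r mulNmx opprK trmx_delta [LHS]mxE [X in - X]mxE.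
by rewrite [X in _ + X]mxE mul_delta_l mul_delta_r.
Qed.
Lemma act_matiE_herm2 x y : (model_act (matiE R i j) t).1.1.1.2 x y =
  - (- ((x == j)%:R * h.1 i y) + h.1 x i * (y == j)%:R).
Proof.
rewrite /= /cmul /= trmx0 !mul0mx !mulmx0 !add0r addr0 mulNmx trmx_delta [LHS]mxE [X in - X]mxE.
by rewrite [X in X + _]mxE mul_delta_l mul_delta_r.
Qed.
Lemma act_matE_std : (model_act (matE R i j) t).1.1.2 =
  (delta_mx i j *m t.1.1.2.1, delta_mx i j *m t.1.1.2.2).
Proof. by rewrite /= /cmul /= !mul0mx subr0 addr0. Qed.
Lemma act_matiE_std : (model_act (matiE R i j) t).1.1.2 =
  (- (delta_mx i j *m t.1.1.2.2), delta_mx i j *m t.1.1.2.1).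
Proof. by rewrite /= /cmul /= !mul0mx sub0r add0r. Qed.
End Generators.
End Model.

Section Embedding.
Variables (R : rcfType) (n' : nat).
Local Notation n := n'.+1.
Variable rho : cmx R 3 3 -> 'M[R]_n.
Hypothesis rep : is_rep rho.
Local Notation H := (rH rho).
Local Notation X := (rE rho).
Local Notation Y := (rF rho).
Local Notation G := (rG rho).
Local Notation wt := (wt rho).
Local Notation is_weight := (is_weight rho).
Local Notation op := (op rho).
Implicit Types (u : 'cV[R]_n).
Hypothesis Wcol : forall i u v, wt (eps (- 2) i) u -> wt (eps (- 2) i) v -> v != 0 ->
  exists r, u = r *: v.
Hypothesis Wcases : forall d, is_weight d ->
  [\/ weq d (eps 0 ord0), exists i, weq d (eps 1 i) | exists i, weq d (eps (- 2) i)].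

Variables (a : 'I_3) (v : 'cV[R]_n).
Hypotheses (v0 : v != 0) (av : wt (eps (- 2) a) v).
Variables (k m : nat) (U : 'M[R]_(n, k)) (T0 : 'M[R]_(n, m)).
Hypothesis UE : forall z : 'cV_k, Evec rho a (U *m z).
Hypothesis T0w : forall z : 'cV_m, wt (eps 0 ord0) (T0 *m z).
Local Notation model := (model R k 0 m).

(* The coefficients are forced by sending the matrix unit u_aa to v: in Her(E^* ),
   E_aj u_aa = - (u_aj + u_ja), i E_aj u_aa = - i (u_aj - u_ja) and
   E_aj^2 u_aa = 2 u_jj. *)
Definition herm_embed (j l : 'I_3) (h : cmx R 3 3) : 'cV[R]_n :=
  h.1 a a *: v - h.1 a j *: (X a j *m v) - h.2 a j *: (Y a j *m v)
  - h.1 a l *: (X a l *m v) - h.2 a l *: (Y a l *m v)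
  + (h.1 j j / 2) *: (X a j *m (X a j *m v)) + (h.1 l l / 2) *: (X a l *m (X a l *m v))
  + h.1 j l *: (X a j *m (X a l *m v)) + h.2 j l *: (X a j *m (Y a l *m v)).

Definition rowc (M : 'M[R]_(3, k)) x : 'cV[R]_k := (row x M)^T.

Definition std_embed (j l : 'I_3) (Z : cmx R 3 k) : 'cV[R]_n :=
  U *m rowc Z.1 a + G a j *m (U *m rowc Z.2 a)
  + (X j a *m (U *m rowc Z.1 j) + Y j a *m (U *m rowc Z.2 j))
  + (X l a *m (U *m rowc Z.1 l) + Y l a *m (U *m rowc Z.2 l)).

Definition embed (j l : 'I_3) (t : model) : 'cV[R]_n := herm_embed j l t.1.1.1 + std_embed j l t.1.1.2 + T0 *m t.2.
Local Notation gH := herm_embed.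
Local Notation gE := std_embed.
Local Notation g := embed.

Section Pair.
Variables (j l : 'I_3).
Hypotheses (aj : a != j) (jl : j != l) (al : a != l).
Let ja : j != a. Proof. by rewrite eq_sym. Qed.
Let la : l != a. Proof. by rewrite eq_sym. Qed.
Let lj : l != j. Proof. by rewrite eq_sym. Qed.

(** The formula treats j and l differently. This symmetry lets equivariance, computed for the
    operators with indices a and j, hold for a and l too. *)
Lemma gH_sym h : Defs.hermitian h -> gH l j h = gH j l h.
Proof.
case=> /matrixP h1 /matrixP h2; rewrite /herm_embed.
have e1 := h1 j l; have e2 := h2 j l; rewrite !mxE in e1 e2.
rewrite (top_cross_EF rep Wcol Wcases v0 av aj jl al) (top_EE_sym rep v aj al) e1 e2.
by gen_mul; mx_ring.
Qed.

Lemma gE_sym Z : gE l j Z = gE j l Z.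
Proof. by rewrite /std_embed (Evec_rG_indep rep la ja lj (UE _)) addrAC. Qed.

Let herm_diag (h : cmx R 3 3) : Defs.hermitian h -> forall x y, h.1 y x = h.1 x y /\ h.2 y x = - h.2 x y.
Proof.
case=> /matrixP h1 /matrixP h2 x y; split; first by have := h1 x y; rewrite mxE.
by have := h2 x y; rewrite !mxE.
Qed.

Let herm2 (h : cmx R 3 3) : Defs.hermitian h -> forall x, h.2 x x = 0.
Proof. by move=> hh x; have [_ e] := herm_diag hh x x; lra. Qed.

Let tXQ := top_EF rep Wcol Wcases v0 av aj jl al.
Let tYP := top_FE rep Wcol Wcases v0 av aj jl al.
Let tYQ := top_FF rep Wcol Wcases v0 av aj jl al.
Let tYX := top_cross_FE rep Wcol Wcases v0 av aj jl al.
Let tYY := top_cross_FF rep Wcol Wcases v0 av aj jl al.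
Let tkZ s := raise_EE rep Wcases av aj jl al s.
Let tkZ' s := raise_EE_side rep Wcases av aj jl al s.
Let tkS s := raise_cross_EE rep Wcases av aj jl al s.
Let tkT s := raise_cross_EF rep Wcases av aj jl al s.

Ltac push := rewrite /herm_embed ?(mulmxDr, mulmxN, =^~ scalemxAr).

(** Here h' stands for E_aj h and enters only through its entries, which are compared with the table
    for P, Q, S, T, Z. *)
Lemma gH_raiseX (h h' : cmx R 3 3) : Defs.hermitian h ->
  (forall x y, h'.1 x y = - ((x == j)%:R * h.1 a y + h.1 x a * (y == j)%:R)) ->
  (forall x y, h'.2 x y = - ((x == j)%:R * h.2 a y + h.2 x a * (y == j)%:R)) ->
  X a j *m gH j l h = gH j l h'.
Proof.
move=> ht E1 E2; push; rewrite !E1 !E2; simp_eq.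
rewrite tXQ (tkZ false) (tkZ' false) (tkS false) (tkT false).
have [e3 e4] := herm_diag ht a j; rewrite ?e3 ?e4 ?(herm2 ht).
by gen_mul; apply/matrixP => ? ?; rewrite !mxE; field.
Qed.

Lemma gH_raiseY (h h' : cmx R 3 3) : Defs.hermitian h ->
  (forall x y, h'.1 x y = - ((x == j)%:R * h.2 a y - h.2 x a * (y == j)%:R)) ->
  (forall x y, h'.2 x y = - (- ((x == j)%:R * h.1 a y) + h.1 x a * (y == j)%:R)) ->
  Y a j *m gH j l h = gH j l h'.
Proof.
move=> ht E1 E2; push; rewrite !E1 !E2; simp_eq.
rewrite tYP tYQ tYX tYY (tkZ true) (tkZ' true) (tkS true) (tkT true).
have [e3 e4] := herm_diag ht a j; rewrite ?e3 ?e4 ?(herm2 ht).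
by gen_mul; apply/matrixP => ? ?; rewrite !mxE; field.
Qed.

Lemma gH_lowerX (h h' : cmx R 3 3) : Defs.hermitian h ->
  (forall x y, h'.1 x y = - ((x == a)%:R * h.1 j y + h.1 x j * (y == a)%:R)) ->
  (forall x y, h'.2 x y = - ((x == a)%:R * h.2 j y + h.2 x j * (y == a)%:R)) ->
  X j a *m gH j l h = gH j l h'.
Proof.
move=> ht E1 E2; push; rewrite !E1 !E2; simp_eq.
rewrite (lower_v rep Wcases av aj false) (lowerE_E rep Wcases av aj)
  (lowerE_F rep Wcol Wcases v0 av aj jl al) (lower_side rep Wcases av aj jl al false false)
  (lower_side rep Wcases av aj jl al false true) (lowerE_EE rep Wcases av aj jl al)
  (lower_EE_side rep Wcases av aj jl al false) (lowerE_cross_EE rep Wcases av aj jl al)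
  (lowerE_cross_EF rep Wcases av aj jl al).
have [e3 e4] := herm_diag ht a j; have [e1 e2] := herm_diag ht j l.
rewrite ?e3 ?e4 ?(herm2 ht).
by rewrite ?e1 ?e2; gen_mul; apply/matrixP => ? ?; rewrite !mxE; field.
Qed.

Lemma gH_lowerY (h h' : cmx R 3 3) : Defs.hermitian h ->
  (forall x y, h'.1 x y = - ((x == a)%:R * h.2 j y - h.2 x j * (y == a)%:R)) ->
  (forall x y, h'.2 x y = - (- ((x == a)%:R * h.1 j y) + h.1 x j * (y == a)%:R)) ->
  Y j a *m gH j l h = gH j l h'.
Proof.
move=> ht E1 E2; push; rewrite !E1 !E2; simp_eq.
rewrite (lower_v rep Wcases av aj true) (lowerF_E rep Wcol Wcases v0 av aj jl al)
  (lowerF_F rep Wcases av aj) (lower_side rep Wcases av aj jl al true false)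
  (lower_side rep Wcases av aj jl al true true) (lowerF_EE rep Wcol Wcases v0 av aj jl al)
  (lower_EE_side rep Wcases av aj jl al true) (lowerF_cross_EE rep Wcol Wcases v0 av aj jl al)
  (lowerF_cross_EF rep Wcol Wcases v0 av aj jl al).
have [e3 e4] := herm_diag ht a j; have [e1 e2] := herm_diag ht j l.
rewrite ?e3 ?e4 ?(herm2 ht).
by rewrite ?e1 ?e2; gen_mul; apply/matrixP => ? ?; rewrite !mxE; field.
Qed.

Lemma rowc_delta (x y z : 'I_3) (M : 'M[R]_(3, k)) :
  rowc (delta_mx x y *m M) z = (z == x)%:R *: rowc M y.
Proof. by apply/matrixP => p q; rewrite !mxE -mul_delta_l mxE. Qed.

Lemma rowcN (z : 'I_3) (M : 'M[R]_(3, k)) : rowc (- M) z = - rowc M z.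
Proof. by apply/matrixP => p q; rewrite !mxE. Qed.

Let kA s u : Evec rho a u -> op s a j *m u = 0.
Proof. by move=> uE; apply: (Evec_kill uE). Qed.
Let kB s t u : Evec rho a u -> op s a j *m (op t l a *m u) = 0.
Proof. by move=> uE; apply: (Evec_kill (Evec_op rep Wcases t la uE)). Qed.
Let kC s t u : Evec rho a u -> op s j a *m (op t j a *m u) = 0.
Proof. by move=> uE; apply: (op_kill_low rep Wcases s ja (Evec_op rep Wcases t ja uE).1). Qed.
Let kD s t u : Evec rho a u -> op s j a *m (op t l a *m u) = 0.
Proof. by move=> uE; apply: (Evec_kill (Evec_op rep Wcases t la uE)) => //; rewrite eq_sym. Qed.
Let bk s t u : Evec rho a u -> op s a j *m (op t j a *m u) = op_sign R s t *: (cartan rho (s (+) t) a j *m u).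
Proof. by move=> uE; apply: Evec_back. Qed.
Let GE u : Evec rho a u -> Evec rho a (G a j *m u).
Proof. exact: (Evec_rG rep Wcases ja). Qed.

Ltac push_E := rewrite /std_embed ?mulmxDr ?(rowcN, rowc_delta); simp_eq;
  rewrite ?scale1r ?scale0r ?oppr0 ?(mulmx0, mulmxN, addr0, add0r).

Lemma gE_raiseX (t : model) : X a j *m gE j l t.1.1.2 = gE j l (model_act (matE R a j) t).1.1.2.
Proof.
rewrite act_matE_std; push_E.
rewrite (kA false (UE _)) (kA false (GE (UE _))) (bk false false (UE _)) (bk false true (UE _)).
rewrite (kB false false (UE _)) (kB false true (UE _)) /op_sign /= !scale1r (Evec_rH ja (UE _)).
by rewrite !(addr0, add0r).
Qed.

Lemma gE_raiseY (t : model) : Y a j *m gE j l t.1.1.2 = gE j l (model_act (matiE R a j) t).1.1.2.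
Proof.
rewrite act_matiE_std; push_E.
rewrite (kA true (UE _)) (kA true (GE (UE _))) (bk true false (UE _)) (bk true true (UE _)).
rewrite (kB true false (UE _)) (kB true true (UE _)) /op_sign /= !scale1r (Evec_rH ja (UE _)).
by rewrite !(addr0, add0r) scaleN1r addrC.
Qed.

Lemma gE_lowerX (t : model) : X j a *m gE j l t.1.1.2 = gE j l (model_act (matE R j a) t).1.1.2.
Proof.
rewrite act_matE_std; push_E.
rewrite (kC false false (UE _)) (kC false true (UE _)) (kD false false (UE _)) (kD false true (UE _)).
by rewrite (Evec_rE_rG rep Wcases ja (UE _)) !addr0.
Qed.

Lemma gE_lowerY (t : model) : Y j a *m gE j l t.1.1.2 = gE j l (model_act (matiE R j a) t).1.1.2.
Proof.
rewrite act_matiE_std; push_E.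
rewrite (kC true false (UE _)) (kC true true (UE _)) (kD true false (UE _)) (kD true true (UE _)).
by rewrite (Evec_rF_rG rep Wcases ja (UE _)) !addr0 addrC.
Qed.

Definition intertwining (A : cmx R 3 3) := forall t : model, Defs.hermitian t.1.1.1 ->
  rho A *m g j l t = g j l (model_act A t).

(** The three summands are treated separately. That of T0 drops out because the vectors of weight 0
    are killed by all root elements. *)
Lemma intertwines_gen : [/\ intertwining (matE R a j), intertwining (matiE R a j),
  intertwining (matE R j a) & intertwining (matiE R j a)].
Proof.
split=> t ht; rewrite /embed (mulmxDr _ (gH j l _ + _)) (mulmxDr _ (gH j l _)) [in RHS]mulmx0.
- rewrite (op_kill_zero rep Wcases false aj (T0w _)) -gE_raiseX; congr (_ + _ + _).
  exact: (gH_raiseX ht (act_matE_herm1 a j t) (act_matE_herm2 a j t)).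
- rewrite (op_kill_zero rep Wcases true aj (T0w _)) -gE_raiseY; congr (_ + _ + _).
  exact: (gH_raiseY ht (act_matiE_herm1 a j t) (act_matiE_herm2 a j t)).
- rewrite (op_kill_zero rep Wcases false ja (T0w _)) -gE_lowerX; congr (_ + _ + _).
  exact: (gH_lowerX ht (act_matE_herm1 j a t) (act_matE_herm2 j a t)).
- rewrite (op_kill_zero rep Wcases true ja (T0w _)) -gE_lowerY; congr (_ + _ + _).
  exact: (gH_lowerY ht (act_matiE_herm1 j a t) (act_matiE_herm2 j a t)).
Qed.
End Pair.
End Embedding.

(** * Decomposition of W into weight spaces *)

Section Iso.
Variables (R : rcfType) (n' : nat).
Local Notation n := n'.+1.
Variable rho : cmx R 3 3 -> 'M[R]_n.
Hypothesis rep : is_rep rho.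
Local Notation H := (rH rho).
Local Notation X := (rE rho).
Local Notation Y := (rF rho).
Local Notation G := (rG rho).
Local Notation wt := (wt rho).
Local Notation is_weight := (is_weight rho).
Local Notation op := (op rho).
Implicit Types (u : 'cV[R]_n).
Hypothesis Wcol : forall i u v, wt (eps (- 2) i) u -> wt (eps (- 2) i) v -> v != 0 ->
  exists r, u = r *: v.
Hypothesis Wcases : forall d, is_weight d ->
  [\/ weq d (eps 0 ord0), exists i, weq d (eps 1 i) | exists i, weq d (eps (- 2) i)].

Lemma weq_dl (x y : R) i j : (x, i) != (y, j) -> x != 0 -> x != - y -> ~~ weq (eps x i) (eps y j).
Proof.
move=> xy x0 xny; apply/negP => /weqP e.
have [ij|ij] := eqVneq i j.
  subst j; have [j [k [ij jk ik]]] := I3_others i.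
  move: (e i j); rewrite /eps; simp_eq => e1; case/eqP: xy; congr (_, _); lra.
have [k [jk ik]] := I3_third ij.
by move: (e i k); rewrite /eps; simp_eq => e1; case/eqP: x0; lra.
Qed.

(** The seven weights -2 e_i, e_i and 0 represent each weight of W exactly once: the norms 16, 4, 0
    separate the three families, and [weq_dl] separates the members of each. *)
Lemma components u : exists (top mid : 'I_3 -> 'cV[R]_n) (z : 'cV[R]_n),
  [/\ forall i, wt (eps (- 2) i) (top i), forall i, wt (eps 1 i) (mid i),
      wt (eps 0 ord0) z & u = \sum_i top i + \sum_i mid i + z].
Proof.
have [pr [prD prw pr1 pr0 prL]] := weight_projections rep.
exists (fun i => pr (eps (- 2) i) u), (fun i => pr (eps 1 i) u), (pr (eps 0 ord0) u).
split=> //.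
rewrite [LHS](prL ([seq eps (- 2) i | i <- index_enum 'I_3] ++ [seq eps 1 i | i <- index_enum 'I_3] ++ [:: eps 0 ord0])).
  by rewrite !big_cat !big_map big_seq1 /= addrA.
have c1 (d : 'I_3 -> R) x i : weq d (eps x i) -> x != 0 ->
    count (fun c => weq c d) [seq eps x k | k <- index_enum 'I_3] = 1%N.
  move=> di x0; rewrite count_map -(@eq_count _ (pred1 i)) ?count_uniq_mem ?index_enum_uniq ?mem_index_enum //.
  move=> k /=; have [->|ki] := eqVneq k i; first by rewrite weq_sym di.
  apply/esym/negbTE/negP => kd; have := weq_trans kd di; apply/negP/weq_dl => //.
    by apply: contraNneq ki => -[->].
  by apply: contraNneq x0 => e; apply/eqP; lra.
have cn (d : 'I_3 -> R) x : wnorm d != 4 * x ^+ 2 -> 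
    count (fun c => weq c d) [seq eps x k | k <- index_enum 'I_3] = 0%N.
  move=> dx; rewrite count_map (@eq_count _ _ pred0) ?count_pred0 // => k /=.
  by apply/negbTE/negP => /wnorm_weq; rewrite wnorm_dl => e; rewrite e eqxx in dx.
move=> d dw; rewrite !count_cat /= addn0.
case: (Wcases dw) => [d0|[i di]|[i di]].
- have N : wnorm d = 0 by rewrite (wnorm_weq d0) wnorm_dl expr0n mulr0.
  rewrite (cn d (- 2)); last by rewrite N; apply/eqP => ?; lra.
  rewrite (cn d 1); last by rewrite N; apply/eqP => ?; lra.
  by rewrite weq_sym d0.
- have N : wnorm d = 4 by rewrite (wnorm_weq di) wnorm_dl expr1n mulr1.
  rewrite (cn d (- 2)); last by rewrite N; apply/eqP => ?; lra.
  rewrite (c1 d 1 i di) ?oner_eq0 //.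
  have [/wnorm_weq|//] := boolP (weq (eps 0 ord0) d); rewrite N wnorm_dl => ?.
  by exfalso; lra.
- have N : wnorm d = 16 by rewrite (wnorm_weq di) wnorm_dl; ring.
  rewrite (cn d 1); last by rewrite N; apply/eqP => ?; lra.
  rewrite (c1 d (- 2) i di) ?oppr_eq0 ?pnatr_eq0 //.
  have [/wnorm_weq|//] := boolP (weq (eps 0 ord0) d).
  by rewrite N wnorm_dl => ?; exfalso; lra.
Qed.

Lemma components_inj (top mid : 'I_3 -> 'cV[R]_n) (z : 'cV[R]_n) :
  (forall i, wt (eps (- 2) i) (top i)) -> (forall i, wt (eps 1 i) (mid i)) ->
  wt (eps 0 ord0) z -> \sum_i top i + \sum_i mid i + z = 0 ->
  [/\ forall i, top i = 0, forall i, mid i = 0 & z = 0].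
Proof.
have N1 : 4 * (- 2) ^+ 2 != 4 * 1 ^+ 2 :> R by apply/eqP => ?; lra.
have N2 : 4 * (- 2) ^+ 2 != 4 * 0 ^+ 2 :> R by apply/eqP => ?; lra.
have N3 : 4 * 1 ^+ 2 != 4 * 0 ^+ 2 :> R by apply/eqP => ?; lra.
have [N1' N2' N3'] : [/\ 4 * 1 ^+ 2 != 4 * (- 2) ^+ 2 :> R,
    4 * 0 ^+ 2 != 4 * (- 2) ^+ 2 :> R & 4 * 0 ^+ 2 != 4 * 1 ^+ 2 :> R].
  by split; apply/eqP => ?; lra.
have [pr [prD prw pr1 pr0 prL]] := weight_projections rep.
move=> wtop wmid wz sum0.
have prz c : pr c 0 = 0 by apply: (addrI (pr c 0)); rewrite -prD !addr0.
have prS c (F : 'I_3 -> 'cV[R]_n) : pr c (\sum_i F i) = \sum_i pr c (F i).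
  by apply: (big_morph (pr c)) => [x y|]; [exact: prD|exact: prz].
have nw c d : wnorm c != wnorm d -> ~~ weq c d by apply: contra => /wnorm_weq ->.
have e c : \sum_i pr c (top i) + \sum_i pr c (mid i) + pr c z = 0.
  by rewrite -!prS -!prD sum0 prz.
have one x i (F : 'I_3 -> 'cV[R]_n) : x != 0 -> (forall i, wt (eps x i) (F i)) ->
    \sum_k pr (eps x i) (F k) = F i.
  move=> x0 wF; rewrite (bigD1 i) //= big1 ?addr0 ?pr1 // => k ki; apply: (pr0 _ _ _ _ (wF k)).
  apply: weq_dl => //; first by apply: contraNneq ki => -[->].
  by apply: contraNneq x0 => e'; apply/eqP; lra.
have none c x (F : 'I_3 -> 'cV[R]_n) : wnorm c != 4 * x ^+ 2 -> (forall i, wt (eps x i) (F i)) ->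
    \sum_k pr c (F k) = 0.
  by move=> cx wF; rewrite big1 // => k _; apply: (pr0 _ _ _ _ (wF k)); apply: nw; rewrite wnorm_dl.
split.
- move=> i; have := e (eps (- 2) i); rewrite one ?oppr_eq0 ?pnatr_eq0 //.
  by rewrite (none _ 1) ?wnorm_dl // (pr0 _ _ _ _ wz) ?addr0 //; apply: nw; rewrite !wnorm_dl.
- move=> i; have := e (eps 1 i); rewrite (none _ (- 2)) ?wnorm_dl //.
  rewrite one ?oner_eq0 // (pr0 _ _ _ _ wz) ?addr0 ?add0r //.
  by apply: nw; rewrite !wnorm_dl.
- have := e (eps 0 ord0); rewrite (none _ (- 2)) ?wnorm_dl // (none _ 1) ?wnorm_dl //.
  by rewrite !add0r pr1.
Qed.
End Iso.

(** * The parts of Her and E inside the weight spaces of e_i *)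

Section Bijection.
Variables (R : rcfType) (n' : nat).
Local Notation n := n'.+1.
Variable rho : cmx R 3 3 -> 'M[R]_n.
Hypothesis rep : is_rep rho.
Local Notation H := (rH rho).
Local Notation X := (rE rho).
Local Notation Y := (rF rho).
Local Notation G := (rG rho).
Local Notation wt := (wt rho).
Local Notation is_weight := (is_weight rho).
Local Notation op := (op rho).
Implicit Types (u : 'cV[R]_n).
Hypothesis Wcol : forall i u v, wt (eps (- 2) i) u -> wt (eps (- 2) i) v -> v != 0 ->
  exists r, u = r *: v.
Hypothesis Wcases : forall d, is_weight d ->
  [\/ weq d (eps 0 ord0), exists i, weq d (eps 1 i) | exists i, weq d (eps (- 2) i)].

Variables (a : 'I_3) (v : 'cV[R]_n).
Hypotheses (v0 : v != 0) (av : wt (eps (- 2) a) v).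
Variables (k m : nat) (U : 'M[R]_(n, k)) (T0 : 'M[R]_(n, m)).
Hypothesis UE : forall z : 'cV_k, Evec rho a (U *m z).
Hypothesis T0w : forall z : 'cV_m, wt (eps 0 ord0) (T0 *m z).
Local Notation model := (model R k 0 m).
Local Notation gH := (herm_embed rho a v).
Local Notation gE := (std_embed rho a U).
Local Notation g := (embed rho a v U T0).
Local Notation intertwines := (intertwining rho a v U T0).

Definition Epart x (z z' : 'cV[R]_k) := X x a *m (U *m z) + Y x a *m (U *m z').

Section Pair.
Variables (j l : 'I_3).
Hypotheses (aj : a != j) (jl : j != l) (al : a != l).
Let ja : j != a. Proof. by rewrite eq_sym. Qed.
Let la : l != a. Proof. by rewrite eq_sym. Qed.
Let lj : l != j. Proof. by rewrite eq_sym. Qed.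
Let E0 : Evec rho a 0. Proof. by have := UE 0; rewrite mulmx0. Qed.

Hypothesis Uinj : forall z z' : 'cV_k, U *m z + G a j *m (U *m z') = 0 -> z = 0 /\ z' = 0.
Hypothesis Uspan : forall u, Evec rho a u -> exists z z' : 'cV_k, u = U *m z + G a j *m (U *m z').

Lemma gHlin r (h h' : cmx R 3 3) :
  gH j l (cadd (cscale r h) h') = r *: gH j l h + gH j l h'.
Proof. 
by rewrite /herm_embed; gen_mul; apply/matrixP => ? ?; rewrite !mxE; field.
Qed.

Lemma rowc_lin r (M M' : 'M[R]_(3, k)) x : rowc (r *: M + M') x = r *: rowc M x + rowc M' x.
Proof. by apply/matrixP => ? ?; rewrite !mxE. Qed.

Lemma gElin r (Z Z' : cmx R 3 k) : gE j l (cadd (cscale r Z) Z') = r *: gE j l Z + gE j l Z'.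
Proof.
rewrite /std_embed /= !rowc_lin !mulmxDr -!scalemxAr; gen_mul; mx_ring.
Qed.

Lemma glin r (t t' : model) : g j l (model_add (model_scale r t) t') = r *: g j l t + g j l t'.
Proof.
rewrite /embed gHlin gElin (mulmxDr T0) -scalemxAr.
move: (gH _ _ _) (gH _ _ _) (gE _ _ _) (gE _ _ _) (T0 *m _) (T0 *m _).
by move=> *; mx_ring.
Qed.

Lemma Epart_E x z z' : x != a -> Evec rho x (Epart x z z').
Proof.
move=> xa; rewrite /Epart -[X x a *m _]scale1r; apply: Evec_lin => //.
  exact: (Evec_op rep Wcases false xa (UE z)).
exact: (Evec_op rep Wcases true xa (UE z')).
Qed.

Lemma base_E z z' : Evec rho a (U *m z + G a j *m (U *m z')).
Proof. by rewrite -[U *m z]scale1r; apply: Evec_lin => //; apply: (Evec_rG rep Wcases ja). Qed.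

Lemma Epart_back x z z' : x != a -> X a x *m Epart x z z' = U *m z + G a j *m (U *m z').
Proof.
move=> xa; rewrite /Epart mulmxDr.
have := Evec_back rep xa (UE z) false false; have := Evec_back rep xa (UE z') false true.
rewrite /op_sign /= !scale1r => -> ->; rewrite (Evec_rH xa (UE z)); congr (_ + _).
have [->//|xj] := eqVneq x j.
exact: (Evec_rG_indep rep xa ja xj (UE _)).
Qed.

(** E_ja and i E_ja kill the E-part, and send the two vectors of Her to 2 v, 0 and to 0, -2 v; so b
    and c are read off. Then E_al brings the E-part back to weight e_a, where U is independent. *)
Lemma mid_inj b c z z' :
  b *: (X a j *m v) + c *: (Y a j *m v) + Epart l z z' = 0 -> [/\ b = 0, c = 0, z = 0 & z' = 0].
Proof.
move=> e.
have kill s : op s j a *m Epart l z z' = 0 by apply: (Evec_kill (Epart_E z z' la)).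
have b0 : b = 0.
  move: (congr1 (mulmx (X j a)) e); rewrite mulmx0 (mulmxDr _ _ (Epart _ _ _)) (mulmxDr _ (_ *: _)) -!scalemxAr (kill false) addr0.
  rewrite (lowerE_E rep Wcases av aj) (lowerE_F rep Wcol Wcases v0 av aj jl al) scaler0 addr0 scalerA.
  by move/eqP; rewrite scaler_eq0 (negPf v0) orbF mulf_eq0 pnatr_eq0 orbF => /eqP.
have c0 : c = 0.
  move: (congr1 (mulmx (Y j a)) e); rewrite mulmx0 (mulmxDr _ _ (Epart _ _ _)) (mulmxDr _ (_ *: _)) -!scalemxAr (kill true) addr0.
  rewrite (lowerF_E rep Wcol Wcases v0 av aj jl al) (lowerF_F rep Wcases av aj) scaler0 add0r scalerA.
  by move/eqP; rewrite scaler_eq0 (negPf v0) orbF mulf_eq0 oppr_eq0 pnatr_eq0 orbF => /eqP.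
move: (congr1 (mulmx (X a l)) e); rewrite b0 c0 !scale0r !add0r mulmx0 Epart_back //.
by case/Uinj.
Qed.

Lemma mid_surj u : wt (eps 1 l) u -> exists b c z z',
  u = b *: (X a j *m v) + c *: (Y a j *m v) + Epart l z z'.
Proof.
move=> lu.
have low s : wt (eps (- 2) a) (op s j a *m u).
  apply: wt_weq (wt_op rep s ja lu); apply: (weqI3 aj jl al);
    by rewrite /eps /root_wt; simp_eq; ring.
have [r rE] := Wcol (low false) av v0; have [r' r'E] := Wcol (low true) av v0.
rewrite /= in rE r'E.
(* The corrections, found from E_ja E_aj v = 2 v and (i E_ja)(i E_aj) v = -2 v, make E_ja and i E_ja
   kill u', so that [Evec_crit] applies. *)
pose u' := (- (r / 2)) *: (X a j *m v) + ((r' / 2) *: (Y a j *m v) + u).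
have wu' : wt (eps 1 l) u'.
  apply: wtD; first by apply/wtZ/(wt_mid rep av aj jl al false).
  by apply: wtD => //; apply/wtZ/(wt_mid rep av aj jl al true).
have ku' s : op s j a *m u' = 0.
  rewrite !mulmxDr -!scalemxAr; case: s => /=.
    rewrite (lowerF_E rep Wcol Wcases v0 av aj jl al) (lowerF_F rep Wcases av aj) r'E scaler0 add0r scalerA.
    by rewrite -scalerDl (_ : _ + _ = 0) ?scale0r //; field.
  rewrite (lowerE_E rep Wcases av aj) (lowerE_F rep Wcol Wcases v0 av aj jl al) rE scaler0 add0r scalerA.
  by rewrite -scalerDl (_ : _ + _ = 0) ?scale0r //; field.
have uE := Evec_crit rep Wcases jl al ja wu' ku'.
have [z [z' zE]] := Uspan (Evec_op rep Wcases false al uE).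
exists (r / 2), (- (r' / 2)), z, z'.
have -> : Epart l z z' = u'.
  have := Evec_back rep al uE false false; rewrite /op_sign /= scale1r (Evec_rH al uE) => <-.
  rewrite zE /= mulmxDr /Epart; congr (_ + _).
  have -> : G a j *m (U *m z') = G a l *m (U *m z') by apply: (Evec_rG_indep rep ja la jl).
  by rewrite (Evec_rE_rG rep Wcases la).
rewrite /u'; gen_mul; mx_ring.
Qed.

(** In Her, E_jl sends u_jl + u_lj to -2 u_ll. In weight e_a the operators E_jl and i E_jl detect
    the coordinates along Her, as they kill the E-part. *)
Lemma sideE_cross_EE : X j l *m (X a j *m (X a l *m v)) = - (X a l *m (X a l *m v)).
Proof.
have := @shift_jk _ _ _ rep a j l aj jl al false false (X a l *m v); rewrite /op_sign /= scale1r; apply.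
have := @opC _ _ _ rep false false j l a l jl al la jl; rewrite /= mulmxA => ->.
by rewrite -mulmxA (top_kill_side rep Wcases av aj jl al false) mulmx0.
Qed.
Lemma sideF_cross_EE : Y j l *m (X a j *m (X a l *m v)) = 0.
Proof.
have := @shift_jk _ _ _ rep a j l aj jl al true false (X a l *m v); rewrite /op_sign /= scale1r => ->.
  by rewrite (top_FE rep Wcol Wcases v0 av al lj aj) oppr0.
have := @opC _ _ _ rep true false j l a l jl al la jl; rewrite /= mulmxA => ->.
by rewrite -mulmxA (top_kill_side rep Wcases av aj jl al true) mulmx0.
Qed.
Lemma sideE_cross_EF : X j l *m (X a j *m (Y a l *m v)) = 0.
Proof.
have := @shift_jk _ _ _ rep a j l aj jl al false false (Y a l *m v); rewrite /op_sign /= scale1r => ->.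
  by rewrite (top_EF rep Wcol Wcases v0 av al lj aj) oppr0.
have := @opC _ _ _ rep false true j l a l jl al la jl; rewrite /= mulmxA => ->.
by rewrite -mulmxA (top_kill_side rep Wcases av aj jl al false) mulmx0.
Qed.
Lemma sideF_cross_EF : Y j l *m (X a j *m (Y a l *m v)) = - (X a l *m (X a l *m v)).
Proof.
have := @shift_jk _ _ _ rep a j l aj jl al true false (Y a l *m v); rewrite /op_sign /= scale1r => ->.
  by rewrite (top_FF rep Wcol Wcases v0 av al lj aj).
have := @opC _ _ _ rep true true j l a l jl al la jl; rewrite /= mulmxA => ->.
by rewrite -mulmxA (top_kill_side rep Wcases av aj jl al true) mulmx0.
Qed.

Let Zl0 : X a l *m (X a l *m v) != 0.
Proof. exact: (top_EE_neq0 rep Wcases v0 av al lj aj). Qed.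

Lemma base_inj b c z z' :
  b *: (X a j *m (X a l *m v)) + c *: (X a j *m (Y a l *m v)) + (U *m z + G a j *m (U *m z')) = 0 ->
  [/\ b = 0, c = 0, z = 0 & z' = 0].
Proof.
move=> e.
have kill s : op s j l *m (U *m z + G a j *m (U *m z')) = 0.
  by apply: (Evec_kill (base_E z z')).
have b0 : b = 0.
  move: (congr1 (mulmx (X j l)) e); rewrite mulmx0 !(mulmxDr (X j l) (_ + _)) (kill false) addr0.
  rewrite mulmxDr -!scalemxAr sideE_cross_EE sideE_cross_EF scaler0 addr0 => /eqP.
  by rewrite scaler_eq0 oppr_eq0 (negPf Zl0) orbF => /eqP.
have c0 : c = 0.
  move: (congr1 (mulmx (Y j l)) e); rewrite mulmx0 !(mulmxDr (Y j l) (_ + _)) (kill true) addr0.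
  rewrite mulmxDr -!scalemxAr sideF_cross_EE sideF_cross_EF scaler0 add0r => /eqP.
  by rewrite scaler_eq0 oppr_eq0 (negPf Zl0) orbF => /eqP.
by move: e; rewrite b0 c0 !scale0r !add0r => /Uinj[].
Qed.

Lemma base_surj u : wt (eps 1 a) u -> exists b c z z',
  u = b *: (X a j *m (X a l *m v)) + c *: (X a j *m (Y a l *m v)) + (U *m z + G a j *m (U *m z')).
Proof.
move=> au.
have low s : wt (eps (- 2) l) (op s j l *m u).
  apply: wt_weq (wt_op rep s jl au); apply: (weqI3 aj jl al);
    by rewrite /eps /root_wt; simp_eq; ring.
have wZ := wt_top rep av al lj aj false false.
have [r rE] := Wcol (low false) wZ Zl0; have [r' r'E] := Wcol (low true) wZ Zl0.
rewrite /= in rE r'E.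
pose u' := r *: (X a j *m (X a l *m v)) + (r' *: (X a j *m (Y a l *m v)) + u).
have wu' : wt (eps 1 a) u'.
  apply: wtD; first by apply/wtZ/(wt_S rep av aj jl al false false).
  by apply: wtD => //; apply/wtZ/(wt_S rep av aj jl al false true).
have ku' s : op s j l *m u' = 0.
  rewrite !mulmxDr -!scalemxAr; case: s => /=.
    by rewrite sideF_cross_EE sideF_cross_EF r'E scaler0 add0r scalerN addNr.
  by rewrite sideE_cross_EE sideE_cross_EF rE scaler0 add0r scalerN addNr.
have [z [z' zE]] := Uspan (Evec_crit rep Wcases ja la jl wu' ku').
exists (- r), (- r'), z, z'; rewrite -zE /u'; gen_mul; mx_ring.
Qed.

End Pair.
End Bijection.

(** * Equivariance and bijectivity of the embedding *)

Section Assembly.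
Variables (R : rcfType) (n' : nat).
Local Notation n := n'.+1.
Variable rho : cmx R 3 3 -> 'M[R]_n.
Hypothesis rep : is_rep rho.
Local Notation H := (rH rho).
Local Notation X := (rE rho).
Local Notation Y := (rF rho).
Local Notation G := (rG rho).
Local Notation wt := (wt rho).
Local Notation is_weight := (is_weight rho).
Local Notation op := (op rho).
Implicit Types (u : 'cV[R]_n).
Hypothesis Wcol : forall i u v, wt (eps (- 2) i) u -> wt (eps (- 2) i) v -> v != 0 ->
  exists r, u = r *: v.
Hypothesis Wcases : forall d, is_weight d ->
  [\/ weq d (eps 0 ord0), exists i, weq d (eps 1 i) | exists i, weq d (eps (- 2) i)].

Variables (a : 'I_3) (v : 'cV[R]_n).
Hypotheses (v0 : v != 0) (av : wt (eps (- 2) a) v).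
Variables (k m : nat) (U : 'M[R]_(n, k)) (T0 : 'M[R]_(n, m)).
Hypothesis UE : forall z : 'cV_k, Evec rho a (U *m z).
Hypothesis T0w : forall z : 'cV_m, wt (eps 0 ord0) (T0 *m z).
Local Notation model := (model R k 0 m).
Local Notation gH := (herm_embed rho a v).
Local Notation gE := (std_embed rho a U).
Local Notation g := (embed rho a v U T0).
Local Notation intertwines := (intertwining rho a v U T0).
Variables (j l : 'I_3).
Hypotheses (aj : a != j) (jl : j != l) (al : a != l).
Let ja : j != a. Proof. by rewrite eq_sym. Qed.
Let la : l != a. Proof. by rewrite eq_sym. Qed.
Let lj : l != j. Proof. by rewrite eq_sym. Qed.

Hypothesis Uinj : forall z z' : 'cV_k, U *m z + G a j *m (U *m z') = 0 -> z = 0 /\ z' = 0.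
Hypothesis Uspan : forall u, Evec rho a u -> exists z z' : 'cV_k, u = U *m z + G a j *m (U *m z').
Hypothesis Tinj : forall z : 'cV_m, T0 *m z = 0 -> z = 0.
Hypothesis Tspan : forall u, wt (eps 0 ord0) u -> exists z : 'cV_m, u = T0 *m z.

Lemma g_sym (t : model) : Defs.hermitian t.1.1.1 -> g l j t = g j l t.
Proof.
move=> ht; rewrite /embed (gH_sym rep Wcol Wcases v0 av aj jl al ht).
by rewrite (gE_sym rep UE aj jl al).
Qed.

Definition intertwined (A : cmx R 3 3) := sl3 A /\ intertwines j l A.

Lemma intertwined_add x A B : intertwined A -> intertwined B -> intertwined (cadd (cscale x A) B).
Proof.
move=> [sA iA] [sB iB]; have sxA := sl3_scale x sA.
split=> [|t ht]; first exact: sl3_add.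
rewrite rhoD // rhoZ // mulmxDl -scalemxAl iA // iB // -glin; congr (embed _ _ _ _ _ _ _ _).
by rewrite model_act_add model_act_scale.
Qed.

Lemma intertwined_lie A B C : intertwined A -> intertwined B -> sl3 C -> lie A B = C -> intertwined C.
Proof.
move=> [sA iA] [sB iB] sC AB; split; first exact: sC.
move=> t ht.
have hA := hermitian_act A ht; have hB := hermitian_act B ht.
rewrite -AB model_act_lie; case: rep => _ rl; rewrite (rl A B sA sB) mulmxBl -!mulmxA iB // iA // iA // iB //.
have -> (s s' : model) : model_add s (model_scale (- 1) s') = model_add (model_scale (- 1) s') s.
  by rewrite /model_add /cadd !(addrC (s.1.1.1.1), addrC (s.1.1.1.2), addrC (s.1.1.2.1), 
    addrC (s.1.1.2.2), addrC s.1.2.1, addrC s.1.2.2, addrC s.2).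
by rewrite glin scaleN1r addrC.
Qed.

Lemma intertwined_gens : 
  [/\ intertwined (matE R a j), intertwined (matiE R a j), intertwined (matE R j a) & intertwined (matiE R j a)] /\
  [/\ intertwined (matE R a l), intertwined (matiE R a l), intertwined (matE R l a) & intertwined (matiE R l a)].
Proof.
have [i1 i2 i3 i4] := intertwines_gen rep Wcol Wcases v0 av UE T0w aj jl al.
have [i5 i6 i7 i8] := intertwines_gen rep Wcol Wcases v0 av UE T0w al lj aj.
have sym A : intertwining rho a v U T0 l j A -> intertwines j l A.
  by move=> iA t ht; rewrite -(g_sym ht) -(g_sym (hermitian_act A ht)); apply: iA.
split; split.
- split; [exact: sl3_matE|exact: i1].
- split; [exact: sl3_matiE|exact: i2].
- split; [exact: sl3_matE|exact: i3].
- split; [exact: sl3_matiE|exact: i4].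
- split; [exact: sl3_matE|exact: sym i5].
- split; [exact: sl3_matiE|exact: sym i6].
- split; [exact: sl3_matE|exact: sym i7].
- split; [exact: sl3_matiE|exact: sym i8].
Qed.

Lemma intertwined_all A : sl3 A -> intertwined A.
Proof.
move=> [tr1 tr2].
have [[g1 g2 g3 g4] [g5 g6 g7 g8]] := intertwined_gens.
have gjl : intertwined (matE R j l) by apply: (intertwined_lie g3 g5); [exact: sl3_matE|lie_delta].
have glj : intertwined (matE R l j) by apply: (intertwined_lie g7 g1); [exact: sl3_matE|lie_delta].
have fjl : intertwined (matiE R j l) by apply: (intertwined_lie g4 g5); [exact: sl3_matiE|lie_delta].
have flj : intertwined (matiE R l j) by apply: (intertwined_lie g8 g1); [exact: sl3_matiE|lie_delta].
have hj : intertwined (matH R j a) by apply: (intertwined_lie g3 g1); [exact: sl3_matH|lie_delta].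
have hl : intertwined (matH R l a) by apply: (intertwined_lie g7 g5); [exact: sl3_matH|lie_delta].
have kj : intertwined (matiH R j a) by apply: (intertwined_lie g4 g1); [exact: sl3_matiH|lie_delta].
have kl : intertwined (matiH R l a) by apply: (intertwined_lie g8 g5); [exact: sl3_matiH|lie_delta].
have tr (M : 'M[R]_3) : \tr M = 0 -> M a a = - M j j - M l l.
  by rewrite /mxtrace (sum_I3 _ aj jl al) => e; lra.
pose c x M := cadd (cscale x M) : cmx R 3 3 -> cmx R 3 3.
(* The diagonal is expressed by H_ja and H_la since the trace is 0. The term [cscale 0 A] only ends
   the chain, so that every summand has the shape of [intertwined_add]. *)
have -> : A = 
   c (A.1 a j) (matE R a j) (c (A.1 j a) (matE R j a) (c (A.1 a l) (matE R a l) (c (A.1 l a) (matE R l a)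
  (c (A.1 j l) (matE R j l) (c (A.1 l j) (matE R l j) (c (A.1 j j) (matH R j a) (c (A.1 l l) (matH R l a)
  (c (A.2 a j) (matiE R a j) (c (A.2 j a) (matiE R j a) (c (A.2 a l) (matiE R a l) (c (A.2 l a) (matiE R l a)
  (c (A.2 j l) (matiE R j l) (c (A.2 l j) (matiE R l j) (c (A.2 j j) (matiH R j a) (c (A.2 l l) (matiH R l a)
   (cscale 0 A)))))))))))))))).
  have c1 x M B : (c x M B).1 = x *: M.1 + B.1 by [].
  have c2 x M B : (c x M B).2 = x *: M.2 + B.2 by [].
  have pairE (P Q : cmx R 3 3) : P.1 = Q.1 -> P.2 = Q.2 -> P = Q.
    by case: P Q => [? ?] [? ?] /= -> ->.
  clearbody c; apply: pairE; [rewrite !c1|rewrite !c2]; apply/matrixP => x y;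
    rewrite /matE /matiE /matH /matiH /= !mxE;
    case/or3P: (I3_cover aj jl al x) => /eqP ->; case/or3P: (I3_cover aj jl al y) => /eqP ->;
    simp_eq; rewrite ?(tr _ tr1) ?(tr _ tr2); ring.
do 16!(apply: intertwined_add; first by []).
split=> [|t ht]; first by split; rewrite /= mxtraceZ mul0r.
rewrite rhoZ // scale0r mul0mx model_act_scale.
have := @glin _ _ rho a v _ _ U T0 j l (-1) (model_act A t) (model_act A t); rewrite scaleN1r addNr => <-.
congr (embed _ _ _ _ _ _ _ _); rewrite /model_add /model_scale /cadd /cscale /=.
by rewrite !scale0r !scaleN1r !addNr.
Qed.

(** Sorted by weight, the diagonal entry h_ii contributes to weight -2 e_i, while row i of Z and the
    entry of h off row and column i contribute to weight e_i. Each component must then vanish. *)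
Lemma g_inj (t : model) : Defs.hermitian t.1.1.1 -> g j l t = 0 -> t = (czero R 3 3, czero R 3 k, czero R 3 0, 0).
Proof.
move=> ht; pose h := t.1.1.1; pose Z := t.1.1.2.
pose top i := if i == a then h.1 a a *: v else if i == j then (h.1 j j / 2) *: (X a j *m (X a j *m v))
   else (h.1 l l / 2) *: (X a l *m (X a l *m v)).
pose mid i := if i == a then
    h.1 j l *: (X a j *m (X a l *m v)) + h.2 j l *: (X a j *m (Y a l *m v)) +
    (U *m rowc Z.1 a + G a j *m (U *m rowc Z.2 a))
  else if i == j then
    (- h.1 a l) *: (X a l *m v) + (- h.2 a l) *: (Y a l *m v) + Epart rho a U j (rowc Z.1 j) (rowc Z.2 j)
  else (- h.1 a j) *: (X a j *m v) + (- h.2 a j) *: (Y a j *m v) + Epart rho a U l (rowc Z.1 l) (rowc Z.2 l).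
have sumE : g j l t = \sum_i top i + \sum_i mid i + T0 *m t.2.
  rewrite !(sum_I3 _ aj jl al) /top /mid; simp_eq; rewrite /embed /herm_embed /std_embed /Epart -/h -/Z.
  by gen_mul; mx_ring.
rewrite sumE => /(components_inj rep)[].
- move=> i; case/or3P: (I3_cover aj jl al i) => /eqP ->; rewrite /top; simp_eq; apply: wtZ => //.
    exact: (wt_top rep av aj jl al false false).
  exact: (wt_top rep av al lj aj false false).
- move=> i; case/or3P: (I3_cover aj jl al i) => /eqP ->; rewrite /mid; simp_eq.
  + apply: wtD; last exact: (base_E rep Wcases UE aj _ _).1.
    by apply: wtD; apply: wtZ; [exact: (wt_S rep av aj jl al false false)|exact: (wt_S rep av aj jl al false true)].
  + apply: wtD; last exact: (Epart_E rep Wcases UE _ _ ja).1.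
    by apply: wtD; apply: wtZ; [exact: (wt_mid rep av al lj aj false)|exact: (wt_mid rep av al lj aj true)].
  + apply: wtD; last exact: (Epart_E rep Wcases UE _ _ la).1.
    by apply: wtD; apply: wtZ; [exact: (wt_mid rep av aj jl al false)|exact: (wt_mid rep av aj jl al true)].
- exact: T0w.
move=> top0 mid0 /Tinj tt0.
have gal : forall z z' : 'cV_k, U *m z + G a l *m (U *m z') = 0 -> z = 0 /\ z' = 0.
  by move=> z z'; rewrite (Evec_rG_indep rep la ja lj (UE z')); exact: Uinj.
have zeroN (x : R) : - x = 0 -> x = 0 by move/eqP; rewrite oppr_eq0 => /eqP.
have ma := mid0 a; rewrite /mid in ma; move: ma; simp_eq.
move=> /(base_inj rep Wcol Wcases v0 av UE aj jl al Uinj)[hjl hjl' Za Za'].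
have mj := mid0 j; rewrite /mid in mj; move: mj; simp_eq.
move=> /(mid_inj rep Wcol Wcases v0 av UE al lj aj gal)[/zeroN hal /zeroN hal' Zj Zj'].
have ml := mid0 l; rewrite /mid in ml; move: ml; simp_eq.
move=> /(mid_inj rep Wcol Wcases v0 av UE aj jl al Uinj)[/zeroN haj /zeroN haj' Zl Zl'].
have ta := top0 a; rewrite /top in ta; move: ta; simp_eq => /eqP.
rewrite scaler_eq0 (negPf v0) orbF => /eqP haa.
have tj := top0 j; rewrite /top in tj; move: tj; simp_eq => /eqP.
rewrite scaler_eq0 (negPf (top_EE_neq0 rep Wcases v0 av aj jl al)) orbF => /eqP hjj.
have tl := top0 l; rewrite /top in tl; move: tl; simp_eq => /eqP.
rewrite scaler_eq0 (negPf (top_EE_neq0 rep Wcases v0 av al lj aj)) orbF => /eqP hll.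
have {}hjj : h.1 j j = 0 by lra.
have {}hll : h.1 l l = 0 by lra.
have [/matrixP h1 /matrixP h2] := ht; rewrite -/h in h1 h2.
have s1 x y : h.1 y x = h.1 x y by have := h1 x y; rewrite mxE.
have s2 x y : h.2 y x = - h.2 x y by have := h2 x y; rewrite !mxE.
have d2 x : h.2 x x = 0 by have := s2 x x; lra.
have rowZ (M : 'M[R]_(3, k)) : rowc M a = 0 -> rowc M j = 0 -> rowc M l = 0 -> M = 0.
  move=> ra rj rl; apply/matrixP => x y; rewrite mxE.
  have -> : M x y = rowc M x y 0 by rewrite !mxE.
  by case/or3P: (I3_cover aj jl al x) => /eqP ->; rewrite ?ra ?rj ?rl mxE.
apply: model_eq => //.
- rewrite -/h [h]surjective_pairing; congr pair; apply/matrixP => x y; rewrite [RHS]mxE;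
  case/or3P: (I3_cover aj jl al x) => /eqP ->; case/or3P: (I3_cover aj jl al y) => /eqP ->;
  rewrite ?d2 // ?(haa, hjj, hll, haj, hal, hjl, haj', hal', hjl') //.
  + by rewrite s1.
  + by rewrite s1.
  + by rewrite s1.
  + by rewrite s2 haj' oppr0.
  + by rewrite s2 hal' oppr0.
  + by rewrite s2 hjl' oppr0.
- by rewrite -/Z [Z]surjective_pairing; congr pair; apply: rowZ.
- by rewrite [LHS]surjective_pairing; congr pair; apply/matrixP => x [].
Qed.

Lemma g_surj u : exists2 t : model, Defs.hermitian t.1.1.1 & g j l t = u.
Proof.
have gal : forall y, Evec rho a y -> exists z z' : 'cV_k, y = U *m z + G a l *m (U *m z').
  move=> y /Uspan[z [z' ->]]; exists z, z'.
  by rewrite (Evec_rG_indep rep la ja lj (UE z')).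
have [top [mid [z [wtop wmid wz ->]]]] := components rep Wcases u.
have [ra ta] := Wcol (wtop a) av v0.
have [rj tj] := Wcol (wtop j) (wt_top rep av aj jl al false false) (top_EE_neq0 rep Wcases v0 av aj jl al).
have [rl tl] := Wcol (wtop l) (wt_top rep av al lj aj false false) (top_EE_neq0 rep Wcases v0 av al lj aj).
have [b1 [c1 [z1 [y1 ma]]]] := base_surj rep Wcol Wcases v0 av aj jl al Uspan (wmid a).
have [b2 [c2 [z2 [y2 mj]]]] := mid_surj rep Wcol Wcases v0 av UE al lj aj gal (wmid j).
have [b3 [c3 [z3 [y3 ml]]]] := mid_surj rep Wcol Wcases v0 av UE aj jl al Uspan (wmid l).
have [tt tE] := Tspan wz.
(* These entries invert [herm_embed]: the factors 2 undo its halves and the minus signs those of its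
   terms in h_aj and h_al. *)
pose h1 : 'M[R]_3 := ra *: delta_mx a a + (2 * rj) *: delta_mx j j + (2 * rl) *: delta_mx l l
   - b2 *: (delta_mx a l + delta_mx l a) - b3 *: (delta_mx a j + delta_mx j a)
   + b1 *: (delta_mx j l + delta_mx l j).
pose h2 : 'M[R]_3 := - c2 *: (delta_mx a l - delta_mx l a) - c3 *: (delta_mx a j - delta_mx j a)
   + c1 *: (delta_mx j l - delta_mx l j).
pose Z1 : 'M[R]_(3, k) := \matrix_(x, y) (if x == a then z1 else if x == j then z2 else z3) y 0.
pose Z2 : 'M[R]_(3, k) := \matrix_(x, y) (if x == a then y1 else if x == j then y2 else y3) y 0.
exists ((h1, h2), (Z1, Z2), (0, 0), tt).
  split; apply/matrixP => x y; rewrite /= /h1 /h2 !mxE;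
    case/or3P: (I3_cover aj jl al x) => /eqP ->; case/or3P: (I3_cover aj jl al y) => /eqP ->;
    simp_eq; ring.
have rZ1 x : rowc Z1 x = if x == a then z1 else if x == j then z2 else z3.
  by apply/matrixP => p q; rewrite !mxE ord1.
have rZ2 x : rowc Z2 x = if x == a then y1 else if x == j then y2 else y3.
  by apply/matrixP => p q; rewrite !mxE ord1.
rewrite !(sum_I3 _ aj jl al) ta tj tl ma mj ml tE.
rewrite /embed /herm_embed /std_embed /Epart /= !rZ1 !rZ2.
simp_eq; rewrite /h1 /h2 !mxE; simp_eq.
by gen_mul; apply/matrixP => ? ?; rewrite !mxE; field.
Qed.

(** f is a chosen inverse of the embedding with hermitian values. Its properties follow by applying
    the embedding, which is injective on elements with hermitian first component. *)
Lemma g_iso : exists f : 'cV[R]_n -> model, model_iso rho f.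
Proof.
have [f fP] : exists f : 'cV[R]_n -> model, forall u, Defs.hermitian (f u).1.1.1 /\ g j l (f u) = u.
  have ex u : exists t : model, Defs.hermitian t.1.1.1 /\ g j l t = u.
    by have [t ht gt] := g_surj u; exists t.
  exists (fun u => proj1_sig (constructive_indefinite_description _ (ex u))) => u.
  exact: proj2_sig (constructive_indefinite_description _ (ex u)).
have herm_lin r (s t : model) : Defs.hermitian s.1.1.1 -> Defs.hermitian t.1.1.1 ->
    Defs.hermitian (model_add (model_scale r s) t).1.1.1.
  case=> s1 s2 [t1 t2]; split; rewrite /= raddfD /= linearZ /=.
    by rewrite s1 t1.
  by rewrite s2 t2 scalerN opprD.
have ginj (s t : model) : Defs.hermitian s.1.1.1 -> Defs.hermitian t.1.1.1 ->
    g j l s = g j l t -> s = t.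
  move=> hs ht st; have := g_inj (herm_lin (- 1) _ _ ht hs).
  rewrite glin scaleN1r st addNr => /(_ erefl).
  case: s t {hs ht st} => [[[[p1 p2] [p3 p4]] [p5 p6]] p7] [[[[q1 q2] [q3 q4]] [q5 q6]] q7] /=.
  rewrite /model_add /model_scale /cadd /cscale /czero /= !scaleN1r.
  have e0 (V : zmodType) (x y : V) : - y + x = 0 -> x = y.
    by rewrite addrC => /eqP; rewrite subr_eq0 => /eqP.
  by case=> /e0 -> /e0 -> /e0 -> /e0 -> /e0 -> /e0 -> /e0 ->.
exists f; split.
- move=> r u w; apply: ginj; first by case: (fP (r *: u + w)).
    by apply: herm_lin; [case: (fP u)|case: (fP w)].
  by rewrite glin !(proj2 (fP _)).
- by move=> u w uw; rewrite -(proj2 (fP u)) uw (proj2 (fP w)).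
- by move=> u; case: (fP u).
- move=> t ht; exists (g j l t); apply: ginj => //; first by case: (fP (g j l t)).
  by rewrite (proj2 (fP _)).
- move=> A u sA; have [hu gu] := fP u; have [_ iA] := intertwined_all sA.
  apply: ginj; [by case: (fP (rho A *m u))|exact: hermitian_act|].
  by rewrite (proj2 (fP _)) -iA // gu.
Qed.
End Assembly.

Lemma model_iso_of_negative_extremal (R : rcfType) (n' : nat) (rho : cmx R 3 3 -> 'M[R]_n'.+1)
    (w : 'cV[R]_n'.+1 -> 'cV[R]_n'.+1 -> 'rV[R]_n'.+1) (x : R) (a : 'I_3) :
  is_rep rho -> sym_bilinear w -> equivariant rho w -> nondeg2 w ->
  0 < x -> is_weight rho (eps (- x) a) ->
  (forall d, is_weight rho d -> wnorm d <= 4 * x ^+ 2) ->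
  exists k m (f : 'cV[R]_n'.+1 -> model R k 0 m), model_iso rho f.
Proof.
move=> rep wbil weqv wnd x0 wa wmax.
have x2 := extremal_coef rep wbil weqv wnd x0 wa wmax; subst x.
have wtop i := extremal_all rep wa i.
have wmax16 d : is_weight rho d -> wnorm d <= 16.
  by move/wmax => le; apply: le_trans le _; rewrite -natrX -natrM ler_nat.
have Wcol := top_collinear rep wbil weqv wnd wmax16.
have Wcases := weight_cases rep wbil weqv wnd wtop wmax16.
have [v v0 av] := wa; have [j [l [aj jl al]]] := I3_others a.
have ja : j != a by rewrite eq_sym.
have E0 : Evec rho a 0 by split=> [|s p q _ _]; [exact: wt0|exact: mulmx0].
have ED r (s t : 'cV[R]_n'.+1) : Evec rho a s -> Evec rho a t -> Evec rho a (r *: s + t).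
  exact: Evec_lin.
(* The complex structure J is G_aj. *)
have [k [U [UE Uinj Uspan]]] := complex_basis E0 ED
  (fun u => @Evec_rG_rG _ _ _ rep Wcases a j u ja).
have wtlin r (s t : 'cV[R]_n'.+1) : wt rho (eps 0 ord0) s -> wt rho (eps 0 ord0) t ->
    wt rho (eps 0 ord0) (r *: s + t).
  by move=> sw tw; apply: wtD => //; apply: wtZ.
have [m [T0 [T0w Tinj Tspan]]] := subspace_basis (wt0 rho _) wtlin.
exists k, m; exact: (g_iso rep Wcol Wcases v0 av UE T0w aj jl al Uinj Uspan Tinj Tspan).
Qed.

(** * The automorphism that reverses the weights *)

Section Contragredient.
Variable R : rcfType.
Implicit Types A B : cmx R 3 3.

(** The transpose is taken without conjugation. On the real diagonal torus this is -1, so composing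
    with it negates every weight. *)
Definition negtr A : cmx R 3 3 := (- A.1^T, - A.2^T).

Lemma negtr_sl3 A : sl3 A -> sl3 (negtr A).
Proof. by case=> t1 t2; split; rewrite /= raddfN /= mxtrace_tr ?t1 ?t2 oppr0. Qed.

Lemma negtrK : involutive negtr.
Proof. by case=> A B; rewrite /negtr /= !raddfN /= !trmxK !opprK. Qed.

Lemma negtr_lin x A B : negtr (cadd (cscale x A) B) = cadd (cscale x (negtr A)) (negtr B).
Proof. by rewrite /negtr /cadd /cscale /=; congr pair; mx_ring. Qed.

Lemma negtr_lie A B : negtr (lie A B) = lie (negtr A) (negtr B).
Proof.
case: A B => [A A'] [B B']; rewrite /negtr /lie /cadd /cneg /cmul /=.
rewrite !mulmxN !mulNmx !opprK -!trmx_mul.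
by congr pair; gen_mul; mx_ring.
Qed.

Lemma negtr_aut : lie_aut negtr.
Proof.
split.
- exact: negtr_sl3.
- by move=> x A B _ _; apply: negtr_lin.
- by move=> A B _ _; apply: negtr_lie.
- by move=> A B _ _ /(can_inj negtrK).
- by move=> B sB; exists (negtr B); [exact: negtr_sl3|exact: negtrK].
Qed.

Lemma negtr_matH i j : negtr (matH R i j) = cscale (- 1) (matH R i j).
Proof. by rewrite /negtr /matH /cscale /= trmx0 oppr0 scaler0 scaleN1r raddfB /= !trmx_delta. Qed.

End Contragredient.

Lemma is_weight_negtr (R : rcfType) n' (rho : cmx R 3 3 -> 'M[R]_n'.+1) c : is_rep rho ->
  is_weight (fun A => rho (negtr A)) (fun k => - c k) <-> is_weight rho c.
Proof.
move=> rep; have HN i j : rho (negtr (matH R i j)) = - rho (matH R i j).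
  by rewrite negtr_matH rhoZ ?scaleN1r //; exact: sl3_matH.
split=> -[v v0 cv]; exists v => // i j; have := cv i j; rewrite /rH HN mulNmx.
  by move/(congr1 -%R); rewrite opprK => ->; rewrite -scaleNr; congr (_ *: _); ring.
by move=> ->; rewrite -scaleNr; congr (_ *: _); ring.
Qed.

Theorem theorem5p6 (R : rcfType) (n : nat) (rho : cmx R 3 3 -> 'M[R]_n)
    (w : 'cV[R]_n -> 'cV[R]_n -> 'rV[R]_n) :
  is_rep rho -> faithful rho ->
  sym_bilinear w -> equivariant rho w -> nondeg2 w ->
  exists phi : cmx R 3 3 -> cmx R 3 3, lie_aut phi /\
  exists k l m : nat, exists f : 'cV[R]_n -> model R k l m,
    model_iso (fun X => rho (phi X)) f.
Proof.
case: n rho w => [|n'] rho w rep faith wbil weqv wnd.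
  (* In dimension 0 every operator is 0, which contradicts faithfulness. *)
  have : matH R ord0 ord_max = czero R 3 3.
    by apply: faith; [exact: sl3_matH|exact: sl3_0|apply/matrixP => [[]]].
  by case=> /matrixP/(_ ord0 ord0)/eqP; rewrite !mxE /= subr0 oner_eq0.
have [x [i [x0 wx wmax]]] := exists_extremal rep wbil weqv wnd faith.
(* The sign of x decides whether the identity or [negtr] brings the extremal weight to the form -
   |x| e_i. *)
case: (ltrgtP x 0) => [xneg|xpos|/eqP]; last by rewrite (negPf x0).
  exists id; split.
    by split=> // B sB; exists B.
  have [|||k [m [f fP]]] := @model_iso_of_negative_extremal R n' rho w (- x) i rep wbil weqv wnd.
  - by rewrite oppr_gt0.
  - by rewrite opprK.
  - by rewrite sqrrN.
  by exists k, 0%N, m, f.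
exists (@negtr R); split; first exact: negtr_aut.
have rep' : is_rep (fun A => rho (negtr A)).
  case: rep => r1 r2; split=> [b A B sA sB|A B sA sB].
    by rewrite negtr_lin r1 //; exact: negtr_sl3.
  by rewrite negtr_lie r2 //; exact: negtr_sl3.
have weqv' : equivariant (fun A => rho (negtr A)) w.
  by move=> A u v sA; apply/weqv/negtr_sl3.
have [|||k [m [f fP]]] := @model_iso_of_negative_extremal R n' _ w x i rep' wbil weqv' wnd.
- exact: xpos.
- apply: is_weight_weq (proj2 (is_weight_negtr (eps x i) rep) wx).
  by apply/weqP => p q; rewrite /eps; ring.
- move=> d dw; have : is_weight rho (fun k => - d k).
    apply/(is_weight_negtr _ rep); apply: is_weight_weq dw.
    by apply/weqP => p q; rewrite !opprK.
  move=> /wmax; rewrite (_ : wnorm _ = wnorm d) // /wnorm; apply: eq_bigr => p _.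
  by apply: eq_bigr => q _; ring.
by exists k, 0%N, m, f.
Qed.
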